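(* Let $a,b\in\Sigma$. Then the geodesic $\delta_{a,b}:[0,1]\to\Sigma$, $\delta_{a,b}(t)=a^{1/2}\left(a^{-1/2}ba^{-1/2}\right)^t a^{1/2}$, is the shortest curve joining $a$ and $b$ in $\Sigma$; that is, for every smooth curve $\gamma:[0,1]\to\Sigma$ with $\gamma(0)=a$ and $\gamma(1)=b$ one has $Length(\delta_{a,b})\le Length(\gamma)$.
   Context: ${\cal A}$ is a von Neumann algebra with a finite, normal, faithful tracial state $\tau$; ${\cal A}_h$ is the real space of selfadjoint elements of ${\cal A}$; $\Sigma=e^{{\cal A}_h}$ is the set of positive invertible elements of ${\cal A}$, an open subset of ${\cal A}_h$ in the operator norm topology, whose tangent space at every point is identified with ${\cal A}_h$. For $a\in\Sigma$ and $x,y\in{\cal A}_h$ put $\langle x,y\rangle_a=\tau(xa^{-1}ya^{-1})$ and $\|x\|_a=\langle x,x\rangle_a^{1/2}$. A smooth curve is a continuously differentiable curve (derivative with respect to the operator norm) $\gamma:[0,1]\to\Sigma$, and its length is $Length(\gamma)=\int_0^1\|\dot\gamma(t)\|_{\gamma(t)}\,dt$. *)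

(* Defs.v *)
From HB Require Import structures.
From mathcomp Require Import all_boot all_order all_algebra.
From mathcomp Require Import sesquilinear.
From mathcomp Require Import complex.
From mathcomp Require Import all_classical all_reals all_analysis.

Set Implicit Arguments.
Unset Strict Implicit.
Unset Printing Implicit Defensive.

Import Order.TTheory GRing.Theory Num.Theory.
Import numFieldNormedType.Exports.

Local Open Scope classical_set_scope.
Local Open Scope complex_scope.
Local Open Scope ring_scope.

(* Operators are plain functions [H -> H], with the pointwise vector space
   structure, composition as product and [id] as unit; a Hilbert space is a
   complete normed space whose norm comes from an inner product [ip], linear in
   its first argument. *)

Definition is_hilbert_norm (R : realType) (H : completeNormedModType R[i])
    (ip : {dot H for Num.conj}) :=
  forall x : H, `|x| ^+ 2 = ip x x.

Section Operators.
Context {R : realType} {H : completeNormedModType R[i]}.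
Implicit Types (S T : H -> H).

Definition bounded_op T :=
  linear T /\ exists M : R, forall x, `|T x| <= M%:C * `|x|.

(* The norm of [H] takes its values in [R[i]], whence the real part. *)
Definition opnorm T : R :=
  sup [set complex.Re `|T x| | x in [set x : H | `|x| <= 1]].

Definition op_cvg {I : Type} (F : set_system I) (u : I -> H -> H) T :=
  opnorm (u i - T) @[i --> F] --> (0 : R).

Definition expop T : H -> H :=
  get [set E : H -> H | bounded_op E /\
    op_cvg \oo (fun n => \sum_(0 <= k < n) (k`!%:R : R[i])^-1 *: iter k T) E].

Definition opinv T : H -> H :=
  get [set S : H -> H | T \o S = id /\ S \o T = id].

Definition commutant (A : set (H -> H)) : set (H -> H) :=
  [set T | bounded_op T /\ forall S, A S -> T \o S = S \o T].

(* Derivative in operator norm of a curve on [0, 1]; one-sided at 0 and 1. *)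
Definition is_op_derivative (gamma : R -> H -> H) (t : R) (D : H -> H) :=
  bounded_op D /\
  op_cvg (within `[0, 1] t^')
    (fun s : R => ((s - t)^-1)%:C *: (gamma s - gamma t)) D.

Definition velocity (gamma : R -> H -> H) (t : R) : H -> H :=
  get [set D | is_op_derivative gamma t D].

Section Trace.
Variable tau : (H -> H) -> R[i].

(* [tau (x a^-1 y a^-1)] is a real number for selfadjoint [x], [y], [a]. *)
Definition metric a x y : R :=
  complex.Re (tau (x \o opinv a \o y \o opinv a)).

Definition metric_norm a x : R := Num.sqrt (metric a x x).

Definition curve_length (gamma : R -> H -> H) : \bar R :=
  (\int[lebesgue_measure]_(t in `[0%R, 1%R])
     (metric_norm (gamma t) (velocity gamma t))%:E)%E.

End Trace.

Section InnerProduct.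
Variable ip : {dot H for Num.conj}.

Definition is_adjoint S T := forall x y, ip (S x) y = ip x (T y).

Definition positive_op T := forall x, 0 <= ip (T x) x.

Definition op_le S T := positive_op (T - S).

Record von_neumann_algebra (A : set (H -> H)) : Prop := {
  vn_bounded : forall T, A T -> bounded_op T;
  vn_adjoint : forall T, A T -> exists2 S, A S & is_adjoint T S;
  vn_bicommutant : commutant (commutant A) = A }.

Section Algebra.
Variable A : set (H -> H).

Definition selfadjoint_part : set (H -> H) :=
  [set T | A T /\ is_adjoint T T].

Definition Sigma : set (H -> H) :=
  [set a | [/\ A a, positive_op a &
               exists b, [/\ A b, a \o b = id & b \o a = id]]].

Definition is_op_supremum (D : set (H -> H)) T :=
  [/\ selfadjoint_part T,
      forall S, D S -> op_le S T &
      forall U, selfadjoint_part U -> (forall S, D S -> op_le S U) ->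
        op_le T U].

Definition op_directed (D : set (H -> H)) :=
  forall S T, D S -> D T -> exists U, [/\ D U, op_le S U & op_le T U].

(* Only the values of [tau] on [A] matter. *)
Record finite_normal_faithful_trace (tau : (H -> H) -> R[i]) : Prop := {
  trace_linear : forall (c : R[i]) S T, A S -> A T ->
    tau (c *: S + T) = c * tau S + tau T;
  trace_ge0 : forall T, A T -> positive_op T -> 0 <= tau T;
  trace_state : tau id = 1;
  trace_comm : forall S T, A S -> A T -> tau (S \o T) = tau (T \o S);
  trace_faithful : forall T, A T -> positive_op T -> tau T = 0 -> T = 0;
  trace_normal : forall (D : set (H -> H)) T,
    D `<=` selfadjoint_part -> D !=set0 -> op_directed D ->
    is_op_supremum D T -> supremums (tau @` D) (tau T) }.

(* For [c] in [Sigma] there is exactly one such [x]. *)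
Definition logop c : H -> H :=
  get [set x | selfadjoint_part x /\ expop x = c].

Definition powop c (t : R) : H -> H := expop (t%:C *: logop c).

Definition geodesic a b (t : R) : H -> H :=
  powop a (1 / 2) \o
  powop (powop a (- (1 / 2)) \o b \o powop a (- (1 / 2))) t \o
  powop a (1 / 2).

Definition smooth_curve (gamma : R -> H -> H) :=
  forall t : R, t \in `[0, 1] ->
    [/\ Sigma (gamma t), exists D, is_op_derivative gamma t D &
        op_cvg (within `[0, 1] (nbhs t)) (velocity gamma) (velocity gamma t)].

End Algebra.
End InnerProduct.
End Operators.

(* Main.v *)
Require Import Defs.
From HB Require Import structures.
From mathcomp Require Import all_boot all_order all_algebra.
From mathcomp Require Import sesquilinear.
From mathcomp Require Import complex.
From mathcomp Require Import all_classical all_reals all_analysis.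
From mathcomp Require Import ssrAC ring lra.

Set Implicit Arguments.
Unset Strict Implicit.
Unset Printing Implicit Defensive.

Import Order.TTheory GRing.Theory Num.Theory.
Import numFieldNormedType.Exports.

Local Open Scope classical_set_scope.
Local Open Scope complex_scope.
Local Open Scope ring_scope.

(** The geodesic from [a] to [b] moves at constant speed: its logarithmic
    derivative is conjugate to one fixed selfadjoint element [Y], the logarithm
    of [a^(-1/2) b a^(-1/2)], so its length is the trace norm
    [|Y|_2 = tau (Y^2)^(1/2)].  The point is that every other curve is at least
    as long.

    The metric is invariant under [x |-> h x h], and [h = a^(-1/2)] moves the
    end points to [1] and [e^Y].  Along a curve [gamma] choose, for every [t],
    some selfadjoint logarithm [L t] of [h (gamma t) h]; its dependence on [t]
    may be arbitrary.  The heart of the proof is an inequality between two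
    selfadjoint elements, [tr_log_difference_le]: with [E = e^X1 - e^X0],

      [|X1 - X0|_2^2 <= tau (E e^(-X1) E e^(-X0))].

    It says that the exponential map increases distances, as it should on a
    space of nonpositive curvature, but in finite-difference form, so that the
    logarithm never has to be differentiated.  For [X1 = L s] and [X0 = L t] the
    right-hand side is [tau (D gamma(s)^-1 D gamma(t)^-1)] with
    [D = gamma s - gamma t], that is, [(s - t)^2] times a quantity tending to
    the squared speed of [gamma] at [t].  Hence [tau (Y (L t))] grows at most at
    the rate [|Y|_2] times the speed, while its total increment is [|Y|_2^2];
    [increment_le_integral] turns the local bound into
    [|Y|_2 <= Length gamma] (lemma [log_length_le]).

    To prove the inequality, put [D = X1 - X0] and
    [psi s = tau (D (e^(s X1) e^(-s X0) - e^(-s X1) e^(s X0)))].  Its derivative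
    [tau (D e^(s X1) D e^(-s X0)) + tau (D e^(-s X1) D e^(s X0))] is the sum of
    the squared trace norms of [z = e^(s X1/2) D e^(-s X0/2)] and
    [w = e^(-s X1/2) D e^(s X0/2)]; as [tau (z* w) = tau (D^2)], positivity of
    the trace on [(z - w)* (z - w)] makes it at least [2 tau (D^2)]
    ([tr_conj_exp_ge]).  So [psi (1/2) >= tau (D^2)].  But
    [psi (1/2) = tau (D K)] for [K = e^(-X1/2) E e^(-X0/2)], and the
    Cauchy-Schwarz inequality bounds it by [|D|_2 |K|_2], where [|K|_2^2] is the
    right-hand side of the claim.

    All this uses only a real normed algebra that is complete, with an
    involution and a positive trace bounded by the norm.  The algebra [A], with
    the operator norm, the adjoint and the real part of [tau], is one
    ([vna_complete_norm], [vna_tracial]).  Logarithms come from the power series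
    of [- log (1 - u)]: if [c] is positive and invertible and [M] is a large
    enough bound of its norm, then [u = 1 - c / M] has norm less than one
    ([contraction_of_positive], [exists_log]). *)

(** * Growth of functions on an interval *)

Section Growth.
Context {R : realType}.

(** The intervals [[x, y]] are anchored at an interior tag [t], as a bound on the
    difference quotients at [t] provides.  The supremum of the points up to which
    [G] has grown at most at rate [e] must be [b], since near it the local bound
    still applies. *)
Lemma nonincreasing_of_local (G : R -> R) (a b : R) : a <= b ->
  (forall t e, a <= t <= b -> 0 < e -> exists2 d : R, 0 < d &
    forall x y, a <= x <= t -> t <= y <= b -> t - d < x -> y < t + d ->
      G y - G x <= e * (y - x)) ->
  G b <= G a.
Proof.
move=> ab Gloc; apply/ler_addgt0Pr => e0 e0_gt0.
pose e := e0 / (b - a + 1).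
have ba1 : 0 < b - a + 1 by lra.
have e_gt0 : 0 < e by rewrite divr_gt0.
pose S := [set t | a <= t <= b /\ G t - G a <= e * (t - a)].
have Sa : S a by split; [lra|rewrite !subrr mulr0].
have Sub : ubound S b by move=> x [/andP[]].
have hS : has_sup S by split; [exists a|exists b].
set c := sup S.
have ac : a <= c by apply: ub_le_sup => //; exists b.
have cb : c <= b by apply: ge_sup => //; exists a.
have [|d d_gt0 Hd] := Gloc c e _ e_gt0; first by rewrite ac cb.
have [x Sx cdx] := sup_adherent d_gt0 hS.
have xc : x <= c by apply: ub_le_sup => //; exists b.
have [/andP[ax xb] Gx] := Sx.
(* a point strictly beyond [c], unless [c = b] *)
pose y := Num.min b (c + d / 2).
have yb : y <= b by rewrite ge_min lexx.
have cy : c <= y by rewrite le_min cb; lra.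
have ycd : y < c + d by rewrite gt_min; apply/orP; right; lra.
have Gyx : G y - G x <= e * (y - x).
  by apply: Hd => //; rewrite ?ax ?xc ?cy ?yb.
have Sy : S y by split; [lra|nra].
have yc : y <= c by apply: ub_le_sup => //; exists b.
have yE : y = b.
  by move: yc; rewrite /y minEle; case: ifP => // _; lra.
move: Sy; rewrite yE => -[_ Gb].
have : e * (b - a) <= e0.
  rewrite /e mulrAC ler_pdivrMr //.
  rewrite ler_pM2l //; lra.
lra.
Qed.

(** Error terms of second order are absorbed by any positive rate of growth. *)
Lemma nonincreasing_of_quadratic (G : R -> R) :
  (forall t, 0 <= t <= 1 -> exists C, forall x y, 0 <= x <= t -> t <= y <= 1 ->
    G y - G x <= C * ((y - t) ^+ 2 + (t - x) ^+ 2)) ->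
  G 1 <= G 0.
Proof.
move=> Gq; apply: nonincreasing_of_local => // t e t01 e0.
have [C HC] := Gq t t01; pose K := Num.max C 0 + 1.
have [CK K0] : C <= K /\ 0 < K.
  by split; rewrite /K; have := le_max C C 0; have := le_max 0 C 0;
     rewrite !lexx orbT /= => *; lra.
exists (e / K) => [|x y xt ty xd yd]; first by rewrite divr_gt0.
have [yK xK] : K * (y - t) <= e /\ K * (t - x) <= e.
  by split; rewrite mulrC -ler_pdivlMr //; lra.
have := HC x y xt ty.
set p := y - t in yK *; set q := t - x in xK *.
have [p0 q0] : 0 <= p /\ 0 <= q by rewrite /p /q; lra.
have -> : y - x = p + q by rewrite /p /q; ring.
have : C * (p ^+ 2 + q ^+ 2) <= K * (p ^+ 2 + q ^+ 2).
  by rewrite ler_wpM2r // addr_ge0 ?sqr_ge0.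
have : K * p * p <= e * p by rewrite ler_wpM2r.
have : K * q * q <= e * q by rewrite ler_wpM2r.
rewrite !expr2; lra.
Qed.

(** The comparison that ends the proof: only an upper bound on the difference
    quotients of [N] is assumed, so [N] need not be differentiable.  The function
    [N t - \int_0^t v] does not increase. *)
Lemma increment_le_integral (N v : R -> R) :
  {within `[0, 1], continuous v} ->
  (forall t e : R, 0 <= t <= 1 -> 0 < e -> exists2 d : R, 0 < d &
    forall s, 0 <= s <= 1 -> `|s - t| < d ->
      `|N s - N t| <= (v t + e) * `|s - t|) ->
  ((N 1 - N 0)%:E <= \int[lebesgue_measure]_(t in `[0%R, 1%R]) (v t)%:E)%E.
Proof.
move=> cv Nloc.
have iv : lebesgue_measure.-integrable `[0, 1] (EFin \o v).
  by apply: continuous_compact_integrable => //; exact: segment_compact.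
pose V (x : R) := (\int[lebesgue_measure]_(t in `[0, x]) v t)%R.
have intV : (\int[lebesgue_measure]_(t in `[0%R, 1%R]) (v t)%:E = (V 1)%:E)%E.
  rewrite /V /Rintegral fineK //; exact: integrable_fin_num.
have V0 : V 0 = 0 by rewrite /V set_itv1 Rintegral_set1.
rewrite intV lee_fin.
suff : N 1 - V 1 <= N 0 - V 0 by rewrite V0; lra.
pose G t := N t - V t; change (G 1 <= G 0).
apply: nonincreasing_of_local => // t e t01 e0.
have e20 : 0 < e / 2 by rewrite divr_gt0.
have [d1 d10 Hd1] := Nloc _ _ t01 e20.
have [d2 d20 Hd2] : exists2 d : R, 0 < d & forall s, 0 <= s <= 1 -> `|s - t| < d ->
    v t - e / 2 <= v s.
  have /subspace_continuousP/(_ t) := cv.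
  rewrite /= in_itv/= => /(_ t01) /cvgrPdist_lt /(_ _ e20).
  rewrite near_withinE => /nbhs_ballP[d /= d0 Hd].
  exists d => // s s01 std.
  have := Hd s; rewrite -ball_normE /ball_ /= in_itv /= distrC => /(_ std s01).
  by rewrite ltr_norml => /andP[_]; rewrite ltrBlDr -ltrBlDl => /ltW.
exists (Num.min d1 d2); first by rewrite lt_min d10.
move=> x y xt ty xd yd.
have [xd1 xd2] : t - d1 < x /\ t - d2 < x.
  by move: xd; rewrite ltrBlDl -ltrBlDr lt_min; lra.
have [yd1 yd2] : y < t + d1 /\ y < t + d2.
  by move: yd; rewrite -ltrBlDl lt_min; lra.
have Hx : `|N t - N x| <= (v t + e / 2) * (t - x).
  have := Hd1 x; rewrite (distrC x) (distrC (N x)) (@ger0_norm _ (t - x)); last lra.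
  by apply; lra.
have Hy : `|N y - N t| <= (v t + e / 2) * (y - t).
  have := Hd1 y; rewrite (@ger0_norm _ (y - t)); last lra.
  by apply; lra.
have Nyx : N y - N x <= (v t + e / 2) * (y - x).
  by move: Hx Hy; rewrite !ler_norml; nra.
have Vyx : (v t - e / 2) * (y - x) <= V y - V x.
  have ivy : lebesgue_measure.-integrable `[0, y] (EFin \o v).
    apply: integrableS iv => //; apply: subset_itvl; rewrite bnd_simp; lra.
  have ivxy : lebesgue_measure.-integrable `]x, y] (EFin \o v).
    apply: integrableS ivy => //; apply: subset_itvr; rewrite bnd_simp; lra.
  rewrite /V Rintegral_itvB //; rewrite ?bnd_simp; try lra.
  have -> : (v t - e / 2) * (y - x)
      = (\int[lebesgue_measure]_(_ in `]x, y]) (v t - e / 2))%R.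
    rewrite Rintegral_cst //= lebesgue_measure_itv /= lte_fin.
    have [xy|] := ltP x y; first by [].
    by move=> yx; rewrite (_ : y = x) ?subrr ?mulr0 //; apply/le_anti; lra.
  apply: le_Rintegral => //.
  - apply/integrableP; split; first exact: measurable_cst.
    rewrite (_ : (fun _ => _) = cst (`|v t - e / 2|%:E)) //.
    rewrite integral_cst //= lebesgue_measure_itv /= lte_fin.
    by case: ifP => _; rewrite ?mule0 ?ltry // -EFinM ltry.
  - move=> s; rewrite /= in_itv /= => xsy; apply: Hd2; first lra.
    by rewrite ltr_norml; lra.
by rewrite /G; nra.
Qed.

(** The step common to all Cauchy-Schwarz inequalities below: a quadratic
    polynomial of constant sign has a nonpositive discriminant. *)
Lemma quadratic_discriminant_le (a b c : R) : 0 <= c ->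
  (forall r, 0 <= a - 2 * r * b + r ^+ 2 * c) -> b ^+ 2 <= a * c.
Proof.
move=> c0 H; have [c00|cn0] := eqVneq c 0.
  rewrite c00 mulr0 le_eqVlt; apply/orP; left.
  rewrite sqrf_eq0; apply: contraT => b0.
  have := H ((a + 1) / (2 * b)); rewrite c00 mulr0 addr0.
  have -> : 2 * ((a + 1) / (2 * b)) * b = a + 1 by field.
  by lra.
have cp : 0 < c by rewrite lt_def cn0.
have := H (b / c).
have -> : a - 2 * (b / c) * b + (b / c) ^+ 2 * c = (a * c - b ^+ 2) / c by field.
by rewrite pmulr_lge0 ?invr_gt0 // subr_ge0.
Qed.

End Growth.

(** * Complete normed algebras *)

(** Convergence to [l] is expressed by [N (u n - l)] tending to [0] in [R], the
    form taken by convergence in operator norm, so that [B] needs no topology of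
    its own. *)
Record complete_algebra_norm (R : realType) (B : algType R) (N : B -> R) : Prop := {
  anormD : forall x y, N (x + y) <= N x + N y ;
  anormZ : forall a x, N (a *: x) = `|a| * N x ;
  anorm_eq0 : forall x, N x = 0 -> x = 0 ;
  anormM : forall x y, N (x * y) <= N x * N y ;
  anorm1 : N 1 <= 1 ;
  anorm_complete : forall u : nat -> B,
    (forall e, 0 < e -> exists n, forall m, (n <= m)%N -> N (u m - u n) <= e) ->
    exists l, N (u n - l) @[n --> \oo] --> (0 : R) }.

Section NormedAlgebra.
Context {R : realType} {B : algType R} {N : B -> R}.
Context (hN : complete_algebra_norm N).
Implicit Types (x y X Y S T : B).

Lemma anorm0 : N 0 = 0.
Proof. by rewrite -(scale0r (0 : B)) (anormZ hN) normr0 mul0r. Qed.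

Lemma anormN x : N (- x) = N x.
Proof. by rewrite -scaleN1r (anormZ hN) normrN1 mul1r. Qed.

Lemma anorm_distC x y : N (x - y) = N (y - x).
Proof. by rewrite -anormN opprB. Qed.

Lemma anorm_ge0 x : 0 <= N x.
Proof.
have := anormD hN x (- x); rewrite subrr anorm0 anormN => h.
by rewrite -(@pmulrn_lge0 _ _ 2) // mulr2n.
Qed.

Lemma anorm_sum (I : Type) (r : seq I) (P : pred I) (F : I -> B) :
  N (\sum_(i <- r | P i) F i) <= \sum_(i <- r | P i) N (F i).
Proof.
elim/big_ind2 : _ => [|x1 r1 x2 r2 h1 h2|//]; first by rewrite anorm0.
by rewrite (le_trans (anormD hN _ _))// lerD.
Qed.

Lemma anormX x k : N (x ^+ k) <= N x ^+ k.
Proof.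
elim: k => [|k IH]; first by rewrite !expr0 (anorm1 hN).
rewrite !exprS (le_trans (anormM hN _ _))//.
by rewrite ler_wpM2l // anorm_ge0.
Qed.

Lemma anorm_le_dist x y : N x <= N y + N (x - y).
Proof. by rewrite -{1}(subrK y x) addrC (le_trans (anormD hN _ _)). Qed.

Lemma acvg_bound (I : Type) (F : set_system I) {FF : Filter F} (u : I -> B) l (v : I -> R) :
  (\forall i \near F, N (u i - l) <= v i) -> v i @[i --> F] --> (0 : R) ->
  N (u i - l) @[i --> F] --> (0 : R).
Proof.
move=> uv v0; apply: (squeeze_cvgr _ (cvg_cst 0) v0).
by near=> i; rewrite anorm_ge0 /=; near: i.
Unshelve. all: by end_near. Qed.

Lemma acvg_unique (I : Type) (F : set_system I) {FF : ProperFilter F} (u : I -> B) l1 l2 :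
  N (u i - l1) @[i --> F] --> (0 : R) -> N (u i - l2) @[i --> F] --> (0 : R) ->
  l1 = l2.
Proof.
move=> u1 u2; apply/eqP; rewrite -subr_eq0; apply/eqP; apply: (anorm_eq0 hN).
apply/eqP; rewrite eq_le anorm_ge0 andbT.
have u12 : N (u i - l1) + N (u i - l2) @[i --> F] --> (0 : R).
  by rewrite -[0]addr0; exact: cvgD.
apply: cvgr_to_ge u12 _; near=> i.
have -> : l1 - l2 = - (u i - l1) + (u i - l2).
  by rewrite opprB addrA subrK.
by rewrite (le_trans (anormD hN _ _))// anormN.
Unshelve. all: by end_near. Qed.

End NormedAlgebra.

Section Limits.
Context {R : realType} {B : algType R} {N : B -> R}.
Context (hN : complete_algebra_norm N).
Context (I : Type) (F : set_system I) {FF : Filter F}.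
Implicit Types (u v : I -> B) (x y : B).

Lemma acvgM u v x y : N (u i - x) @[i --> F] --> (0 : R) ->
  N (v i - y) @[i --> F] --> (0 : R) ->
  N (u i * v i - x * y) @[i --> F] --> (0 : R).
Proof.
move=> ux vy.
apply: (acvg_bound hN (v := fun i =>
  N (u i - x) * N (v i - y) + N (u i - x) * N y + N x * N (v i - y))).
  near=> i.
  have -> : u i * v i - x * y
    = (u i - x) * (v i - y) + (u i - x) * y + x * (v i - y).
    by rewrite -mulrDr subrK mulrBl mulrBr addrA subrK.
  rewrite (le_trans (anormD hN _ _))// lerD ?(anormM hN)//.
  by rewrite (le_trans (anormD hN _ _))// lerD ?(anormM hN).
have -> : (0 : R) = 0 * 0 + 0 * N y + N x * 0 by rewrite !mul0r mulr0 !addr0.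
by apply: cvgD; [apply: cvgD|]; apply: cvgM => //; exact: cvg_cst.
Unshelve. all: by end_near. Qed.

Lemma acvg_le {PF : ProperFilter F} u x (c : R) :
  N (u i - x) @[i --> F] --> (0 : R) -> (\forall i \near F, N (u i) <= c) ->
  N x <= c.
Proof.
move=> ux uc.
have uc0 : c + N (u i - x) @[i --> F] --> c.
  by rewrite -[X in _ --> X]addr0; apply: cvgD => //; exact: cvg_cst.
apply: cvgr_to_ge uc0 _; near=> i.
rewrite (le_trans (anorm_le_dist hN x (u i)))// (anorm_distC hN) lerD2r.
by near: i.
Unshelve. all: by end_near. Qed.

End Limits.

Section Summable.
Context {R : realType} {B : algType R} {N : B -> R}.
Context (hN : complete_algebra_norm N).

(** An absolutely dominated series converges, because its partial sums form a
    Cauchy sequence. *)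
Lemma acvg_series (a : nat -> B) (c : nat -> R) :
  (forall k, N (a k) <= c k) -> cvgn (series c) ->
  exists l, N (\sum_(0 <= k < n) a k - l) @[n --> \oo] --> (0 : R).
Proof.
move=> ac cc; apply: (anorm_complete hN) => e e0.
have [L cL] := (cvg_ex _).1 cc.
have c0 k : 0 <= c k := le_trans (anorm_ge0 hN _) (ac k).
have cLn m : series c m <= L.
  by rewrite -(cvg_lim _ cL)//; apply: nondecreasing_cvgn_le => //;
     exact: nondecreasing_series.
have /cvgrPdist_le/(_ e e0)[n _ Hn] := cL.
exists n => m nm.
rewrite (@big_cat_nat _ _ _ n) //= addrAC subrr add0r.
rewrite (le_trans (anorm_sum hN _ _ _))//.
apply: (@le_trans _ _ (\sum_(n <= i < m) c i)).
  by apply: ler_sum => i _; exact: ac.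
have -> : \sum_(n <= i < m) c i = series c m - series c n.
  by rewrite /series /= (@big_cat_nat _ _ _ n 0%N m) //= addrAC subrr add0r.
have := Hn n (leqnn n); rewrite /= ler_norml; have := cLn m; lra.
Qed.

End Summable.

(** * The exponential of a normed algebra *)

Section Triangle.

(** Summation over the triangle [i + j < n] by diagonals and by rows. *)
Lemma sum_triangle (V : nmodType) (f : nat -> nat -> V) n :
  \sum_(0 <= k < n) \sum_(0 <= i < k.+1) f (k - i)%N i =
  \sum_(0 <= i < n) \sum_(0 <= j < n - i) f j i.
Proof.
elim: n => [|n IH]; first by rewrite !big_geq.
rewrite big_nat_recr //= IH [RHS]big_nat_recr //= subSnn.
rewrite [in RHS]big_nat1.
transitivity (\sum_(0 <= i < n) (\sum_(0 <= j < n - i) f j i + f (n - i)%N i)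
   + f 0%N n).
  by rewrite big_split /= -addrA; congr +%R; rewrite big_nat_recr //= subnn.
congr +%R; rewrite !big_nat; apply: eq_bigr => i /andP[_ ilen].
by rewrite subSn 1?ltnW // [RHS]big_nat_recr.
Qed.

Context {R : realType} {B : algType R}.
Implicit Types (S T X : B).

Definition exp_partial X n : B := \sum_(0 <= k < n) (k`!%:R : R)^-1 *: X ^+ k.

(** The terms missing from the triangular partial sum have nonnegative
    coefficients in [S] and [T].  The same identity in [R] therefore controls the
    norm of this difference. *)
Lemma exp_partialD_comm S T n : GRing.comm S T ->
  exp_partial S n * exp_partial T n - exp_partial (S + T) n =
  \sum_(0 <= i < n) \sum_(n - i <= j < n)
    ((j`!%:R)^-1 * (i`!%:R)^-1) *: (S ^+ j * T ^+ i).
Proof.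
move=> ST; pose f j i := ((j`!%:R)^-1 * (i`!%:R)^-1 : R) *: (S ^+ j * T ^+ i).
have -> : exp_partial (S + T) n =
    \sum_(0 <= k < n) \sum_(0 <= i < k.+1) f (k - i)%N i.
  apply: eq_bigr => k _; rewrite exprDn_comm // scaler_sumr big_mkord.
  apply: eq_bigr => i _; rewrite /f -scalerMnr scalerMnl; congr (_ *: _); rewrite -[LHS]mulr_natl.
  have ik : (i <= k)%N by rewrite -ltnS.
  have kE := bin_fact ik; have := congr1 (fun m => m%:R : R) kE.
  rewrite !natrM => {}kE.
  have nz m : m`!%:R != 0 :> R by rewrite pnatr_eq0 -lt0n fact_gt0.
  rewrite -kE; field.
  by rewrite !nz pnatr_eq0 -lt0n bin_gt0 ik.
rewrite sum_triangle /exp_partial mulr_sumr -sumrB.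
apply: eq_bigr => i _.
rewrite mulr_suml (@big_cat_nat _ _ _ (n - i)%N _ _ xpredT (fun j => _ * _)) ?leq_subr //=.
rewrite addrAC [X in X + _](_ : _ = 0) ?add0r.
  by apply: eq_bigr => j _; rewrite -scalerAl -scalerAr scalerA.
rewrite -sumrB big1 // => j _.
by rewrite /f -scalerAl -scalerAr scalerA subrr.
Qed.

End Triangle.

Section Exponential.
Context {R : realType} {B : algType R} {N : B -> R}.
Context (hN : complete_algebra_norm N).
Implicit Types (S T X D : B).

Definition aexp X : B :=
  xget 0 [set E | N (exp_partial X n - E) @[n --> \oo] --> (0 : R)].

Let scaled_power_le X k m : N ((m`!%:R : R)^-1 *: X ^+ k) <= N X ^+ k / m`!%:R.
Proof.
rewrite (anormZ hN) ger0_norm ?invr_ge0 // mulrC.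
by rewrite ler_wpM2r ?invr_ge0 // (anormX hN).
Qed.

Let expR_partial_le (x : R) n : 0 <= x -> \sum_(0 <= k < n) x ^+ k / k`!%:R <= expR x.
Proof.
move=> x0; apply: (nondecreasing_cvgn_le (u_ := series (exp_coeff x))).
  by apply: nondecreasing_series => i _ _; rewrite /exp_coeff /= divr_ge0 ?exprn_ge0.
exact: is_cvg_series_exp_coeff.
Qed.

Lemma exp_partial_le X n : N (exp_partial X n) <= expR (N X).
Proof.
apply: le_trans (expR_partial_le n (anorm_ge0 hN X)).
by rewrite (le_trans (anorm_sum hN _ _ _))// ler_sum.
Qed.

Lemma aexp_cvg X : N (exp_partial X n - aexp X) @[n --> \oo] --> (0 : R).
Proof.
apply: (@xgetPex _ 0 [set E | N (exp_partial X n - E) @[n --> \oo] --> (0 : R)]).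
apply: (acvg_series hN (c := exp_coeff (N X))).
  by move=> k; exact: scaled_power_le.
exact: is_cvg_series_exp_coeff.
Qed.

Lemma aexp_le X : N (aexp X) <= expR (N X).
Proof.
by apply: (acvg_le hN (aexp_cvg X)); near=> n; exact: exp_partial_le.
Unshelve. all: by end_near. Qed.

(** This second-order estimate is the only information about the series from
    which derivatives of exponentials are obtained. *)
Lemma aexp_order1 X : N (aexp X - 1 - X) <= N X ^+ 2 * expR (N X).
Proof.
have h : N (exp_partial X n.+2 - 1 - X - (aexp X - 1 - X)) @[n --> \oo] --> (0 : R).
  have := cvg_comp _ _ (cvg_addnr 2) (aexp_cvg X).
  apply: cvg_trans; apply: near_eq_cvg; near=> n; rewrite /= addn2.
  by congr N; rewrite !opprB !addrA !subrK.
apply: (acvg_le hN h); near=> n.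
have -> : exp_partial X n.+2 - 1 - X
    = \sum_(0 <= k < n) ((k.+2)`!%:R : R)^-1 *: X ^+ k.+2.
  rewrite /exp_partial big_nat_recl // big_nat_recl // expr0 expr1 !fact0.
  by rewrite invr1 !scale1r [1 + _]addrC addrK [X + _]addrC addrK.
rewrite (le_trans (anorm_sum hN _ _ _))//.
apply: (@le_trans _ _ (N X ^+ 2 * \sum_(0 <= k < n) N X ^+ k / k`!%:R)).
  rewrite mulr_sumr; apply: ler_sum => k _.
  rewrite (le_trans (scaled_power_le _ _ _))// mulrA -exprD.
  rewrite ler_wpM2l ?exprn_ge0 ?(anorm_ge0 hN) //.
  rewrite lef_pV2 ?posrE ?ltr0n ?fact_gt0 // ler_nat.
  by rewrite leq_fact // leqW // leqW.
by rewrite ler_wpM2l ?sqr_ge0 // expR_partial_le // (anorm_ge0 hN).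
Unshelve. all: by end_near. Qed.

(** The difference of the two sides is a limit of the terms left out of the
    Cauchy product.  They are dominated by those of the real exponential at the
    norms of [S] and [T], where the identity is known. *)
Lemma aexpD_comm S T : GRing.comm S T -> aexp (S + T) = aexp S * aexp T.
Proof.
move=> ST.
have h1 := acvgM hN (aexp_cvg S) (aexp_cvg T).
have h2 := aexp_cvg (S + T).
have h3 : N (exp_partial S n * exp_partial T n - exp_partial (S + T) n)
    @[n --> \oo] --> (0 : R).
  pose e (x : R) n := \sum_(0 <= k < n) x ^+ k / k`!%:R.
  have ecvg x : e x n @[n --> \oo] --> expR x by exact: is_cvg_series_exp_coeff.
  apply: (@squeeze_cvgr _ _ _ _ (fun=> 0)
    (fun n => e (N S) n * e (N T) n - e (N S + N T) n)).
  - near=> n; rewrite (anorm_ge0 hN) /= exp_partialD_comm //.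
    have eE (x : R) : e x n = exp_partial (x : R^o) n.
      by apply: eq_bigr => k _; rewrite mulrC.
    rewrite !eE (@exp_partialD_comm R R^o); last exact: mulrC.
    rewrite (le_trans (anorm_sum hN _ _ _))// ler_sum // => i _.
    rewrite (le_trans (anorm_sum hN _ _ _))// ler_sum // => j _.
    rewrite (anormZ hN) ger0_norm ?mulr_ge0 ?invr_ge0 //.
    rewrite ler_wpM2l ?mulr_ge0 ?invr_ge0 //.
    rewrite (le_trans (anormM hN _ _))// ler_pM ?(anorm_ge0 hN) ?(anormX hN) //.
  - exact: cvg_cst.
  - rewrite [X in _ --> X](_ : _ = expR (N S) * expR (N T) - expR (N S + N T)).
      by apply: cvgB => //; apply: cvgM.
    by rewrite expRD subrr.
apply: (acvg_unique hN h2).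
apply: (acvg_bound hN (v := fun n =>
  N (exp_partial S n * exp_partial T n - exp_partial (S + T) n) +
  N (exp_partial S n * exp_partial T n - aexp S * aexp T))).
  near=> n.
  rewrite (anorm_distC hN (exp_partial S n * exp_partial T n) (exp_partial (S + T) n)).
  rewrite (le_trans _ (anormD hN _ _)) //.
  by rewrite addrA subrK.
by rewrite -[X in _ --> X]addr0; apply: cvgD; [exact: h3|exact: h1].
Unshelve. all: by end_near. Qed.

Lemma aexp0 : aexp 0 = 1.
Proof.
apply: (acvg_unique hN (aexp_cvg 0)).
apply: cvg_near_cst; near=> n.
rewrite /exp_partial -(prednK (_ : 0 < n)%N); last by near: n; exists 1%N.
rewrite big_nat_recl // big1 => [|i _]; last by rewrite exprS mul0r scaler0.
by rewrite fact0 invr1 scale1r expr0 addr0 subrr (anorm0 hN).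
Unshelve. all: by end_near. Qed.

Lemma aexpN X : aexp X * aexp (- X) = 1.
Proof.
by rewrite -aexpD_comm ?subrr ?aexp0 // /GRing.comm mulrN mulNr.
Qed.

Lemma aexpNV X : aexp (- X) * aexp X = 1.
Proof. by have := aexpN (- X); rewrite opprK. Qed.

Lemma acvg_comm (I : Type) (F : set_system I) {FF : ProperFilter F}
    (u : I -> B) l T :
  N (u i - l) @[i --> F] --> (0 : R) -> (forall i, GRing.comm (u i) T) ->
  GRing.comm l T.
Proof.
move=> ul uT.
have cT : N (T - T) @[_ --> F] --> (0 : R).
  by rewrite subrr (anorm0 hN); exact: cvg_cst.
have h1 : N (u i * T - l * T) @[i --> F] --> (0 : R) by exact: (acvgM hN ul cT).
have h2 : N (T * u i - T * l) @[i --> F] --> (0 : R) by exact: (acvgM hN cT ul).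
rewrite /GRing.comm; apply: (acvg_unique hN h1).
by under eq_fun do rewrite uT.
Qed.

Lemma exp_partial_comm S T n : GRing.comm S T -> GRing.comm (exp_partial S n) T.
Proof.
move=> ST; apply/commr_sym/commr_sum => k _.
by apply/commr_sym; rewrite /GRing.comm -scalerAl -scalerAr;
   congr (_ *: _); exact/commr_sym/commrX/commr_sym.
Qed.

Lemma aexp_comm S T : GRing.comm S T -> GRing.comm (aexp S) T.
Proof.
move=> ST; apply: (acvg_comm (aexp_cvg S)) => n; exact: exp_partial_comm.
Qed.

Lemma acvg_aexp (I : Type) (F : set_system I) {FF : ProperFilter F}
    (u : I -> B) l :
  N (u i - l) @[i --> F] --> (0 : R) -> (forall i, GRing.comm (u i) l) ->
  N (aexp (u i) - aexp l) @[i --> F] --> (0 : R).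
Proof.
move=> ul ucl; pose d i := N (u i - l).
apply: (acvg_bound hN (v := fun i =>
   N (aexp l) * (d i ^+ 2 * expR (d i) + d i))).
  near=> i.
  have -> : aexp (u i) - aexp l
      = aexp l * ((aexp (u i - l) - 1 - (u i - l)) + (u i - l)).
    rewrite subrK mulrBr mulr1 -aexpD_comm ?[l + _]addrC ?subrK //.
    by apply: commrB => //; exact/commr_sym/ucl.
  rewrite (le_trans (anormM hN _ _))// ler_wpM2l ?(anorm_ge0 hN) //.
  by rewrite (le_trans (anormD hN _ _))// lerD2r aexp_order1.
have -> : (0 : R) = N (aexp l) * (0 ^+ 2 * expR 0 + 0).
  by rewrite expr0n mul0r addr0 mulr0.
apply: cvgM; first exact: cvg_cst.
apply: cvgD => //; apply: cvgM; first by rewrite !expr2; apply: cvgM.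
apply: continuous_cvg => //; exact: continuous_expR.
Unshelve. all: by end_near. Qed.

Lemma aexp_half X : aexp (2^-1 *: X) * aexp (2^-1 *: X) = aexp X.
Proof.
rewrite -aexpD_comm // -scalerDl; congr aexp.
by rewrite (_ : _ + _ = 1 :> R) ?scale1r //; field.
Qed.

Lemma aexp_scalar (k : R) : aexp (k *: 1) = expR k *: (1 : B).
Proof.
apply: (acvg_unique hN (aexp_cvg (k *: 1))).
apply: (acvg_bound hN (v := fun n => `|series (exp_coeff k) n - expR k|)).
  near=> n; have -> : exp_partial (k *: (1 : B)) n = series (exp_coeff k) n *: 1.
    rewrite /exp_partial /series /= scaler_suml; apply: eq_bigr => i _.
    by rewrite exprZn expr1n scalerA mulrC.
  by rewrite -scalerBl (anormZ hN) ler_piMr // (anorm1 hN).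
rewrite -[X in _ --> X](_ : `|expR k - expR k| = 0); last by rewrite subrr normr0.
apply: cvg_norm; apply: cvgB; last exact: cvg_cst.
exact: is_cvg_series_exp_coeff.
Unshelve. all: by end_near. Qed.

End Exponential.
Arguments aexp {R B} N X.

(** * Curves with a quadratic tangent *)

(** A derivative with an explicit remainder of second order.  Every curve built
    from exponentials has one, and the estimates below become arithmetic with
    constants instead of limits. *)
Definition quadratic_tangent (R : realType) (V : lmodType R) (N : V -> R)
    (F : R -> V) (t : R) (D : V) :=
  exists C, forall s, `|s - t| <= 1 ->
    N (F s - F t - (s - t) *: D) <= C * (s - t) ^+ 2.

Section Tangent.
Context {R : realType} {B : algType R} {N : B -> R}.
Context (hN : complete_algebra_norm N).
Implicit Types (S T X D E : B) (F G : R -> B).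
Notation exp := (aexp N).
Notation tangent := (quadratic_tangent N).

Lemma tangent_bound F t D : tangent F t D ->
  exists2 C, 0 <= C & forall s, `|s - t| <= 1 ->
    N (F s - F t - (s - t) *: D) <= C * `|s - t| ^+ 2 /\
    N (F s - F t) <= (N D + C) * `|s - t|.
Proof.
move=> [C HC]; exists (Num.max C 0); first by rewrite le_max lexx orbT.
move=> s st; have h0 := normr_ge0 (s - t).
have H2 : N (F s - F t - (s - t) *: D) <= Num.max C 0 * `|s - t| ^+ 2.
  rewrite (le_trans (HC s st))// -[(s - t) ^+ 2]real_normK ?num_real //.
  by rewrite ler_wpM2r ?exprn_ge0 // le_max lexx.
split=> //; rewrite (le_trans (anorm_le_dist hN _ ((s - t) *: D)))//.
rewrite (anormZ hN) mulrDl mulrC lerD2l (le_trans H2)// ler_wpM2l //.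
  by rewrite le_max lexx orbT.
by rewrite expr2 ler_piMr.
Qed.

Lemma tangentM F G t D E : tangent F t D -> tangent G t E ->
  tangent (fun s => F s * G s) t (D * G t + F t * E).
Proof.
move=> /tangent_bound[C C0 HF] /tangent_bound[C' C'0 HG].
exists (C * (N (G t) + (N E + C')) + N (F t) * C' + N D * (N E + C')).
move=> s st; have [F2 F1] := HF s st; have [G2 G1] := HG s st.
set h := s - t in st F1 F2 G1 G2 *.
rewrite -[h ^+ 2]real_normK ?num_real //.
have h0 : 0 <= `|h| by [].
have -> : F s * G s - F t * G t - h *: (D * G t + F t * E) =
  (F s - F t - h *: D) * G s + F t * (G s - G t - h *: E)
  + (h *: D) * (G s - G t).
  rewrite !mulrBl !mulrBr scalerDr -!scalerAl -!scalerAr opprD !addrA.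
  by rewrite [RHS](ACl (2*4*3*7*1*5*8*6)) /= addNr add0r addNr add0r.
have GsE : N (G s) <= N (G t) + (N E + C').
  rewrite (le_trans (anorm_le_dist hN _ (G t)))// lerD2l (le_trans G1)//.
  by rewrite ler_piMr // addr_ge0 // (anorm_ge0 hN).
rewrite (le_trans (anormD hN _ _))// [leRHS]mulrDl lerD //.
  rewrite (le_trans (anormD hN _ _))// [leRHS]mulrDl lerD //.
    by rewrite (le_trans (anormM hN _ _))// mulrAC ler_pM ?(anorm_ge0 hN).
  by rewrite (le_trans (anormM hN _ _))// -mulrA ler_wpM2l ?(anorm_ge0 hN).
rewrite (le_trans (anormM hN _ _))// (anormZ hN).
rewrite [leRHS](_ : _ = `|h| * N D * ((N E + C') * `|h|)); last by ring.
by rewrite ler_wpM2l // mulr_ge0 // (anorm_ge0 hN).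
Qed.

Lemma tangentD F G t D E : tangent F t D -> tangent G t E ->
  tangent (fun s => F s + G s) t (D + E).
Proof.
move=> [C HF] [C' HG]; exists (C + C') => s st.
have -> : F s + G s - (F t + G t) - (s - t) *: (D + E)
  = (F s - F t - (s - t) *: D) + (G s - G t - (s - t) *: E).
  rewrite scalerDr !opprD !addrA.
  by rewrite [LHS](ACl (1*3*5*2*4*6)).
by rewrite (le_trans (anormD hN _ _))// mulrDl lerD ?HF ?HG.
Qed.

Lemma tangent_cst X t : tangent (fun=> X) t 0.
Proof.
by exists 0 => s _; rewrite scaler0 subr0 subrr (anorm0 hN) mul0r.
Qed.

Lemma tangent_congruence g F t D : tangent F t D ->
  tangent (fun s => g * F s * g) t (g * D * g).
Proof.
move=> FD; have := tangentM (tangentM (tangent_cst g t) FD) (tangent_cst g t).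
by rewrite mul0r add0r mulr0 addr0.
Qed.

Lemma tangentZ a F t D : tangent F t D -> tangent (fun s => a *: F s) t (a *: D).
Proof.
move=> [C HC]; exists (`|a| * C) => s st.
rewrite scalerA (mulrC _ a) -scalerA -!scalerBr (anormZ hN) -mulrA.
by rewrite ler_wpM2l // HC.
Qed.

Lemma tangentN F t D : tangent F t D -> tangent (fun s => - F s) t (- D).
Proof.
move=> [C HC]; exists C => s st.
by rewrite scalerN -!opprD (anormN hN) HC.
Qed.

Lemma tangent_line X t : tangent (fun s => s *: X) t X.
Proof.
by exists 0 => s _; rewrite scalerBl subrr (anorm0 hN) mul0r.
Qed.

Lemma tangent_sum n (F : nat -> R -> B) t (D : nat -> B) :
  (forall k, tangent (F k) t (D k)) ->
  tangent (fun s => \sum_(0 <= k < n) F k s) t (\sum_(0 <= k < n) D k).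
Proof.
move=> FD; elim: n => [|n IH].
  rewrite big_geq // (_ : (fun _ => _) = fun=> 0); first exact: tangent_cst.
  by apply/funext => s; rewrite big_geq.
rewrite big_nat_recr //= (_ : (fun _ => _) = fun s => \sum_(0 <= k < n) F k s + F n s).
  exact: tangentD.
by apply/funext => s; rewrite big_nat_recr.
Qed.

Lemma tangentX X t k :
  tangent (fun s => (s *: X) ^+ k.+1) t (k.+1%:R *: ((t *: X) ^+ k * X)).
Proof.
elim: k => [|k IH].
  rewrite expr0 mul1r scale1r; under [fun s => _]eq_fun do rewrite expr1.
  exact: tangent_line.
have := tangentM IH (tangent_line X t).
rewrite (_ : (fun s => _) = fun s => (s *: X) ^+ k.+2); last first.
  by apply/funext => s; rewrite [RHS]exprSr.
congr (quadratic_tangent _ _ _ _).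
rewrite -[k.+2]addn1 natrD scalerDl scale1r; congr (_ + _).
by rewrite -scalerAl -scalerAr exprSr -!mulrA -scalerAl -scalerAr.
Qed.

(** As [L s] and [L t] commute, the exponential of [L s] is that of [L t] times
    the exponential of the increment, to which the second-order estimate at the
    origin applies. *)
Lemma tangent_exp (L : R -> B) t D : tangent L t D ->
  (forall s, GRing.comm (L s) (L t)) ->
  tangent (fun s => exp (L s)) t (exp (L t) * D).
Proof.
move=> /tangent_bound[C C0 HL] Lt.
have K0 : 0 <= N D + C by rewrite addr_ge0 // (anorm_ge0 hN).
exists (N (exp (L t)) * ((N D + C) ^+ 2 * expR (N D + C) + C)) => s st.
have [L2 L1] := HL s st; set h := s - t in st L2 L1 *.
rewrite -[h ^+ 2]real_normK ?num_real //.
have -> : exp (L s) - exp (L t) - h *: (exp (L t) * D) = exp (L t) *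
    ((exp (L s - L t) - 1 - (L s - L t)) + (L s - L t - h *: D)).
  rewrite addrA subrK !mulrBr mulr1 -(aexpD_comm hN) ?[L t + _]addrC ?subrK ?scalerAr //.
  by apply: commrB => //; exact/commr_sym/Lt.
rewrite (le_trans (anormM hN _ _))// -mulrA ler_wpM2l ?(anorm_ge0 hN) //.
rewrite (le_trans (anormD hN _ _))// [leRHS]mulrDl lerD //.
rewrite (le_trans (aexp_order1 hN _))// [leRHS]mulrAC ler_pM ?expR_ge0 ?exprn_ge0 ?(anorm_ge0 hN) //.
  by rewrite -exprMn lerXn2r ?nnegrE ?(anorm_ge0 hN) ?mulr_ge0.
by rewrite ler_expR (le_trans L1)// ler_piMr.
Qed.

Lemma tangent_expZ X t : tangent (fun s => exp (s *: X)) t (exp (t *: X) * X).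
Proof.
apply: (tangent_exp (tangent_line X t)) => s.
by rewrite /GRing.comm -!scalerAl -!scalerAr !scalerA mulrC.
Qed.

Lemma real_tangent_increment_ge (f d : R -> R) (m : R) :
  (forall t, 0 <= t <= 1 -> quadratic_tangent (fun x : R^o => `|x|) f t (d t)) ->
  (forall t, 0 <= t <= 1 -> m <= d t) -> m <= f 1 - f 0.
Proof.
move=> fd dm; pose G t := m * t - f t.
suff : G 1 <= G 0 by rewrite /G mulr0 mulr1; lra.
apply: nonincreasing_of_quadratic => t t01.
have [C HC] := fd t t01; exists C => x y xt ty.
have hx := HC x; have hy := HC y.
have {hx} : `|f x - f t - (x - t) * d t| <= C * (x - t) ^+ 2.
  by apply: hx; rewrite ler_norml; lra.
have {hy} : `|f y - f t - (y - t) * d t| <= C * (y - t) ^+ 2.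
  by apply: hy; rewrite ler_norml; lra.
have : m * (y - x) <= d t * (y - x) by rewrite ler_wpM2r ?dm //; lra.
rewrite !ler_norml /G; lra.
Qed.

(** The mean value inequality for curves in the algebra. *)
Lemma tangent_increment_le F (D : R -> B) K : 0 <= K ->
  (forall t, 0 <= t <= 1 -> tangent F t (D t)) ->
  (forall t, 0 <= t <= 1 -> N (D t) <= K) -> N (F 1 - F 0) <= K.
Proof.
move=> K0 FD DK; pose G t := N (F t - F 0) - K * t.
suff : G 1 <= G 0 by rewrite /G subrr (anorm0 hN) mulr0 mulr1; lra.
apply: nonincreasing_of_quadratic => t t01.
have [C C0 HC] := tangent_bound (FD t t01).
have loc s : 0 <= s <= 1 -> N (F s - F t) <= K * `|s - t| + C * (s - t) ^+ 2.
  move=> s01; have [|H2 _] := HC s; first by rewrite ler_norml; lra.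
  rewrite (le_trans (anorm_le_dist hN _ ((s - t) *: D t)))// (anormZ hN) mulrC.
  by rewrite -[(s - t) ^+ 2]real_normK ?num_real // lerD // ler_wpM2r // DK.
exists C => x y xt ty.
have Hx : N (F t - F x) <= K * (t - x) + C * (t - x) ^+ 2.
  rewrite (anorm_distC hN) -[in _ ^+ 2]opprB sqrrN.
  have := loc x; rewrite (distrC x) (@ger0_norm _ (t - x)); last lra.
  by apply; lra.
have Hy : N (F y - F t) <= K * (y - t) + C * (y - t) ^+ 2.
  have := loc y; rewrite (@ger0_norm _ (y - t)); last lra.
  by apply; lra.
have : N (F y - F 0) <= N (F x - F 0) + N (F t - F x) + N (F y - F t).
  have -> : F y - F 0 = (F x - F 0) + (F t - F x) + (F y - F t).
    by rewrite !addrA [RHS](ACl (1*4*3*6*5*2)) /= subrr add0r subrr add0r.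
  by rewrite (le_trans (anormD hN _ _))// lerD2r (anormD hN).
by rewrite /G; lra.
Qed.

End Tangent.

(** * The logarithm near the unit *)

Section Logarithm.
Context {R : realType} {B : algType R} {N : B -> R}.
Context (hN : complete_algebra_norm N).
Implicit Types (u S T X : B).
Notation exp := (aexp N).
Notation tangent := (quadratic_tangent N).

(** Partial sums of [- log (1 - u)]; the sign keeps all coefficients
    nonnegative. *)
Definition log_partial u n : B := \sum_(0 <= k < n) (k.+1%:R : R)^-1 *: u ^+ k.+1.

Let geometric_le (r : R) n : 0 <= r < 1 -> \sum_(0 <= k < n) r ^+ k.+1 <= (1 - r)^-1.
Proof.
move=> /andP[r0 r1]; have r10 : 0 < 1 - r by lra.
rewrite -[leRHS]mul1r ler_pdivlMr //.
under eq_bigr do rewrite exprS.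
rewrite -mulr_sumr big_mkord -mulrA (mulrC _ (1 - r)) -opprB mulNr -subrX1 opprB.
have : 0 <= r ^+ n by rewrite exprn_ge0.
have : r ^+ n <= 1 by rewrite exprn_ile1 // ltW.
nra.
Qed.

Let log_term_le u k : N u < 1 -> N ((k.+1%:R : R)^-1 *: u ^+ k.+1) <= N u ^+ k.+1.
Proof.
move=> u1; rewrite (anormZ hN) ger0_norm ?invr_ge0 //.
rewrite (le_trans _ (anormX hN _ _)) // ler_piMl ?(anorm_ge0 hN) //.
by rewrite invf_le1 // ler1n.
Qed.

Lemma log_partial_le u n : N u < 1 -> N (log_partial u n) <= (1 - N u)^-1.
Proof.
move=> u1; apply: le_trans (geometric_le n _); last by rewrite (anorm_ge0 hN).
by rewrite (le_trans (anorm_sum hN _ _ _))// ler_sum // => k _; exact: log_term_le.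
Qed.

Lemma log_partial_comm S T n : GRing.comm S T -> GRing.comm (log_partial S n) T.
Proof.
move=> ST; apply/commr_sym/commr_sum => k _.
by apply/commr_sym; rewrite /GRing.comm -scalerAl -scalerAr;
   congr (_ *: _); exact/commr_sym/commrX/commr_sym.
Qed.

(** With [L s] the partial sum at [s u], the derivative of
    [s |-> exp (L s) (1 - s u)] telescopes to [- exp (L s) (s u)^n u], which is
    small for [s] in [[0, 1]], and the curve starts at [1]. *)
Lemma exp_log_partial_close u n : N u < 1 ->
  N (exp (log_partial u n) * (1 - u) - 1) <= expR (1 - N u)^-1 * N u ^+ n.
Proof.
move=> u1; have u0 := anorm_ge0 hN u.
pose L s := log_partial (s *: u) n.
pose F s := exp (L s) * (1 - s *: u).
have sub s : 0 <= s <= 1 -> N (s *: u) <= N u.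
  move=> /andP[s0 s1]; rewrite (anormZ hN) ger0_norm //; exact: ler_piMl.
have -> : exp (log_partial u n) * (1 - u) - 1 = F 1 - F 0.
  rewrite /F /L !scale1r scale0r subr0 mulr1; congr (_ - _).
  rewrite [log_partial 0 n]big1 ?(aexp0 hN) // => k _.
  by rewrite exprS mul0r scaler0.
pose D t := - (exp (L t) * ((t *: u) ^+ n * u)).
apply: (tangent_increment_le hN (D := D)).
- by rewrite mulr_ge0 ?expR_ge0 ?exprn_ge0.
- move=> t t01.
  have tL : tangent L t (\sum_(0 <= k < n) (t *: u) ^+ k * u).
    have := tangent_sum hN n (fun k => tangentZ hN (k.+1%:R)^-1 (tangentX hN u t k)).
    congr (quadratic_tangent _ _ _ _); apply: eq_bigr => k _.
    by rewrite scalerA mulVf ?scale1r // pnatr_eq0.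
  have cL s : GRing.comm (L s) (L t).
    apply: log_partial_comm; apply/commr_sym; apply: log_partial_comm.
    by rewrite /GRing.comm -!scalerAl -!scalerAr !scalerA mulrC.
  have := tangentM hN (tangent_exp hN tL cL)
    (tangentD hN (tangent_cst hN 1 t) (tangentN hN (tangent_line hN u t))).
  congr (quadratic_tangent _ _ _ _).
  rewrite add0r -!mulrA -mulrDr /D -mulrN; congr (_ * _).
  rewrite -mulr_suml -mulrA.
  have -> : u * (1 - t *: u) = (1 - t *: u) * u.
    by rewrite mulrBr mulrBl mulr1 mul1r -scalerAl -scalerAr.
  rewrite mulrA -[X in _ - X]mul1r -[X in _ + X]mulNr -mulrDl -mulNr; congr (_ * _).
  have -> : (\sum_(0 <= i < n) (t *: u) ^+ i) * (1 - t *: u) = 1 - (t *: u) ^+ n.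
    rewrite -opprB mulrN big_mkord.
    have -> : (\sum_(i < n) (t *: u) ^+ i) * (t *: u - 1) = (t *: u) ^+ n - 1.
      rewrite subrX1; apply/commr_sym/commr_sum => i _.
      apply/commrX/commr_sym/commrB; [exact: commr_refl|exact: commr1].
    by rewrite opprB.
  by rewrite addrC addrA addNr add0r.
- move=> t t01; rewrite /D (anormN hN) (le_trans (anormM hN _ _))//.
  rewrite ler_pM ?(anorm_ge0 hN) //.
    rewrite (le_trans (aexp_le hN _))// ler_expR.
    rewrite (le_trans (log_partial_le _ _)) ?(le_lt_trans (sub t t01)) //.
    rewrite lef_pV2 ?posrE; have := sub t t01; lra.
  rewrite (le_trans (anormM hN _ _))//.
  rewrite -[leRHS]mulr1 ler_pM ?(anorm_ge0 hN) ?(ltW u1) //.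
  rewrite (le_trans (anormX hN _ _))// lerXn2r ?nnegrE ?(anorm_ge0 hN) ?sub //.
Qed.

Lemma log_series u : N u < 1 -> exists L,
  N (log_partial u n - L) @[n --> \oo] --> (0 : R) /\ exp L * (1 - u) = 1.
Proof.
move=> u1; have u0 := anorm_ge0 hN u.
have nu : `|N u| < 1 by rewrite ger0_norm.
have [L uL] : exists L, N (log_partial u n - L) @[n --> \oo] --> (0 : R).
  apply: (acvg_series hN (c := geometric (N u) (N u))).
    by move=> k; rewrite /geometric /= -exprS; exact: log_term_le.
  exact: is_cvg_geometric_series.
exists L; split=> //.
have Lu : GRing.comm L u.
  by apply: (acvg_comm hN uL) => n; exact/log_partial_comm/commr_refl.
have eL : N (exp (log_partial u n) - exp L) @[n --> \oo] --> (0 : R).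
  by apply: (acvg_aexp hN uL) => n; apply/log_partial_comm/commr_sym.
have c1 : N ((1 - u) - (1 - u)) @[n --> \oo] --> (0 : R).
  by rewrite subrr (anorm0 hN); exact: cvg_cst.
have h1 : N (exp (log_partial u n) * (1 - u) - exp L * (1 - u)) @[n --> \oo] --> (0 : R).
  exact: (acvgM hN eL c1).
apply: (acvg_unique hN h1).
apply: (acvg_bound hN (v := fun n => expR (1 - N u)^-1 * N u ^+ n)).
  by near=> n; exact: exp_log_partial_close.
by apply: (cvg_geometric (expR (1 - N u)^-1) nu).
Unshelve. all: by end_near. Qed.

End Logarithm.

(** * Traces and the exponential *)

(** The trace is real valued: it stands for the real part of a complex trace,
    which is all that the metric involves. *)
Record tracial_involution (R : realType) (B : algType R) (N : B -> R)
    (star : B -> B) (tr : B -> R) : Prop := {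
  starD : forall x y, star (x + y) = star x + star y ;
  starZ : forall a x, star (a *: x) = a *: star x ;
  starM : forall x y, star (x * y) = star y * star x ;
  starK : involutive star ;
  star_le : forall x, N (star x) <= N x ;
  trD : forall x y, tr (x + y) = tr x + tr y ;
  trZ : forall a x, tr (a *: x) = a * tr x ;
  trC : forall x y, tr (x * y) = tr (y * x) ;
  tr_star : forall x, tr (star x) = tr x ;
  tr_ge0 : forall x, 0 <= tr (star x * x) ;
  tr_le : forall x, `|tr x| <= N x }.

Section Tracial.
Context {R : realType} {B : algType R} {N : B -> R} {star : B -> B} {tr : B -> R}.
Context (hN : complete_algebra_norm N) (hT : tracial_involution N star tr).
Implicit Types (x y S T X Y D : B).
Notation exp := (aexp N).
Notation tangent := (quadratic_tangent N).

Lemma starN x : star (- x) = - star x.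
Proof. by rewrite -scaleN1r (starZ hT) scaleN1r. Qed.

Lemma starB x y : star (x - y) = star x - star y.
Proof. by rewrite (starD hT) starN. Qed.

Lemma star0 : star 0 = 0.
Proof. by rewrite -(scale0r (0 : B)) (starZ hT) !scale0r. Qed.

Lemma star1 : star 1 = 1.
Proof. by rewrite -[LHS]mulr1 -[X in _ * X](starK hT) -(starM hT) mulr1 (starK hT). Qed.

Lemma starX x k : star (x ^+ k) = star x ^+ k.
Proof. by elim: k => [|k IH]; rewrite ?expr0 ?star1 // exprS exprSr (starM hT) IH. Qed.

Lemma star_sum (I : Type) (r : seq I) (P : pred I) (F : I -> B) :
  star (\sum_(i <- r | P i) F i) = \sum_(i <- r | P i) star (F i).
Proof. exact: (big_morph star (starD hT) star0). Qed.

Lemma trN x : tr (- x) = - tr x.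
Proof. by rewrite -scaleN1r (trZ hT) mulN1r. Qed.

Lemma trB x y : tr (x - y) = tr x - tr y.
Proof. by rewrite (trD hT) trN. Qed.

Lemma acvg_star_fixed (I : Type) (F : set_system I) {FF : ProperFilter F}
    (u : I -> B) l :
  N (u i - l) @[i --> F] --> (0 : R) -> (forall i, star (u i) = u i) ->
  star l = l.
Proof.
move=> ul us; apply: (acvg_unique hN _ ul).
apply: (acvg_bound hN (v := fun i => N (u i - l))) => //.
by near=> i; rewrite -{1}us -starB (star_le hT).
Unshelve. all: by end_near. Qed.

Lemma star_exp X : star X = X -> star (exp X) = exp X.
Proof.
move=> sX; apply: (acvg_star_fixed (aexp_cvg hN X)) => n.
by rewrite star_sum; apply: eq_bigr => k _; rewrite (starZ hT) starX sX.
Qed.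

Lemma star_log_partial X n : star X = X -> star (log_partial X n) = log_partial X n.
Proof.
by move=> sX; rewrite star_sum; apply: eq_bigr => k _; rewrite (starZ hT) starX sX.
Qed.

Lemma tr_cauchy_schwarz x y :
  tr (star x * y) ^+ 2 <= tr (star x * x) * tr (star y * y).
Proof.
set a := tr (star x * x); set c := tr (star y * y); set b := tr (star x * y).
have yx : tr (star y * x) = b by rewrite -(tr_star hT) (starM hT) (starK hT).
have c0 : 0 <= c by exact: (tr_ge0 hT).
apply: quadratic_discriminant_le => // r.
have h := tr_ge0 hT (x - r *: y).
rewrite starB (starZ hT) mulrBl !mulrBr -!scalerAl -!scalerAr scalerA in h.
rewrite !trB !(trZ hT) yx -/a -/b -/c in h.
by move: h; congr (0 <= _); ring.
Qed.

(** Both terms on the right are squared trace norms, of the elements [z] and [w]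
    of the proof; each of the mixed terms [tr (z* w)] and [tr (w* z)] is
    [tr (D * D)], so the claim is positivity on [(z - w)* (z - w)]. *)
Lemma tr_conj_exp_ge X0 X1 D : star X0 = X0 -> star X1 = X1 -> star D = D ->
  2 * tr (D * D) <= tr (D * (exp X1 * D * exp (- X0)))
                  + tr (D * (exp (- X1) * D * exp X0)).
Proof.
move=> s0 s1 sD.
have sE k X : star X = X -> star (exp (k *: X)) = exp (k *: X).
  by move=> sX; apply: star_exp; rewrite (starZ hT) sX.
pose z := exp (2^-1 *: X1) * D * exp (- (2^-1 *: X0)).
pose w := exp (- (2^-1 *: X1)) * D * exp (2^-1 *: X0).
have sE' X : star X = X -> star (exp (- (2^-1 *: X))) = exp (- (2^-1 *: X)).
  by move=> sX; rewrite -scaleNr sE.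
have sz : star z = exp (- (2^-1 *: X0)) * D * exp (2^-1 *: X1).
  by rewrite !(starM hT) sD (sE' _ s0) (sE 2^-1 _ s1) mulrA.
have sw : star w = exp (2^-1 *: X0) * D * exp (- (2^-1 *: X1)).
  by rewrite !(starM hT) sD (sE' _ s1) (sE 2^-1 _ s0) mulrA.
have halfN X : exp (- (2^-1 *: X)) * exp (- (2^-1 *: X)) = exp (- X).
  by rewrite -scalerN (aexp_half hN).
have := tr_ge0 hT (z - w); rewrite starB mulrBl !mulrBr !trB sz sw.
have -> : tr (exp (- (2^-1 *: X0)) * D * exp (2^-1 *: X1) * z)
    = tr (D * (exp X1 * D * exp (- X0))).
  rewrite -!mulrA (trC hT) -(halfN X0) -(aexp_half hN X1); congr tr.
  by rewrite /z -!mulrA.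
have -> : tr (exp (2^-1 *: X0) * D * exp (- (2^-1 *: X1)) * w)
    = tr (D * (exp (- X1) * D * exp X0)).
  rewrite -!mulrA (trC hT) -(halfN X1) -(aexp_half hN X0); congr tr.
  by rewrite /w -!mulrA.
have -> : tr (exp (- (2^-1 *: X0)) * D * exp (2^-1 *: X1) * w) = tr (D * D).
  rewrite -!mulrA (trC hT) /w; congr tr.
  rewrite -!mulrA (aexpN hN (2^-1 *: X0)) mulr1.
  by rewrite !mulrA -(mulrA D) (aexpN hN (2^-1 *: X1)) mulr1.
have -> : tr (exp (2^-1 *: X0) * D * exp (- (2^-1 *: X1)) * z) = tr (D * D).
  rewrite -!mulrA (trC hT) /z; congr tr.
  rewrite -!mulrA (aexpNV hN (2^-1 *: X0)) mulr1.
  by rewrite !mulrA -(mulrA D) (aexpNV hN (2^-1 *: X1)) mulr1.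
lra.
Qed.

Lemma tangent_tr F t D : tangent F t D ->
  quadratic_tangent (fun x : R^o => `|x|) (fun s => tr (F s)) t (tr D).
Proof.
move=> [C HC]; exists C => s st.
by rewrite /GRing.scale /= -(trZ hT) -!trB (le_trans (tr_le hT _))// HC.
Qed.

Lemma tangent_exp_exp X Y t :
  tangent (fun s => exp (s *: X) * exp (- (s *: Y))) t
    (exp (t *: X) * (X - Y) * exp (- (t *: Y))).
Proof.
have h := tangent_expZ hN (- Y) t.
have := tangentM hN (tangent_expZ hN X t) h.
under [fun s => _ * _]eq_fun do rewrite scalerN.
congr (quadratic_tangent _ _ _ _).
rewrite scalerN -!mulrA -mulrDr; congr (_ * _).
rewrite mulrBl mulrN; congr (_ - _).
apply: (aexp_comm hN); rewrite /GRing.comm mulrN mulNr -scalerAl -scalerAr //.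
Qed.

(** The exponential increases distances, without any infinitesimals.  The right
    side is the squared norm of [E], the difference of the exponentials, for the
    metric with one of its two inverse base points taken at each end. *)
Lemma tr_log_difference_le X0 X1 : star X0 = X0 -> star X1 = X1 ->
  tr ((X1 - X0) * (X1 - X0)) <=
  tr ((exp X1 - exp X0) * exp (- X1) * (exp X1 - exp X0) * exp (- X0)).
Proof.
move=> s0 s1; set D := X1 - X0; set E := exp X1 - exp X0.
have sD : star D = D by rewrite starB s0 s1.
pose Y0 := 2^-1 *: X0; pose Y1 := 2^-1 *: X1.
have sY X : star X = X -> star (2^-1 *: X) = 2^-1 *: X.
  by move=> sX; rewrite (starZ hT) sX.
pose K s := exp (s *: Y1) * exp (- (s *: Y0)) - exp (s *: - Y1) * exp (- (s *: - Y0)).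
have DE : Y1 - Y0 = 2^-1 *: D by rewrite scalerBr.
have K1ge : tr (D * D) <= tr (D * K 1) - tr (D * K 0).
  pose d t := tr (D * (exp (t *: Y1) * (Y1 - Y0) * exp (- (t *: Y0))
     - exp (t *: - Y1) * (- Y1 - - Y0) * exp (- (t *: - Y0)))).
  apply: (@real_tangent_increment_ge _ (fun s => tr (D * K s)) d) => t _.
    have := tangentM hN (tangent_cst hN D t)
      (tangentD hN (tangent_exp_exp Y1 Y0 t) (tangentN hN (tangent_exp_exp (- Y1) (- Y0) t))).
    by rewrite mul0r add0r => /tangent_tr.
  have dE : d t = 2^-1 * (tr (D * (exp (t *: Y1) * D * exp (- (t *: Y0))))
                        + tr (D * (exp (- (t *: Y1)) * D * exp (t *: Y0)))).
    have NDE : - Y1 - - Y0 = - (2^-1 *: D) by rewrite -opprD DE.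
    rewrite /d NDE DE !scalerN opprK mulrN mulNr opprK mulrDr (trD hT) mulrDr.
    by congr (_ + _); rewrite -(trZ hT) -scalerAr -scalerAl -scalerAr.
  have sZ X : star X = X -> star (t *: (2^-1 *: X)) = t *: (2^-1 *: X).
    by move=> sX; rewrite (starZ hT) sY.
  have := tr_conj_exp_ge (sZ _ s0) (sZ _ s1) sD.
  by rewrite dE -/Y0 -/Y1; lra.
have K0 : K 0 = 0 by rewrite /K !scale0r oppr0 subrr.
rewrite K0 mulr0 in K1ge.
have tr0 : tr 0 = 0 by rewrite -(scale0r (0 : B)) (trZ hT) mul0r.
rewrite tr0 subr0 in K1ge.
have sE X : star X = X -> star (exp X) = exp X by exact: star_exp.
have KE : K 1 = exp (- Y1) * E * exp (- Y0).
  rewrite /K /E !scale1r opprK mulrBr mulrBl -(aexp_half hN X0) -(aexp_half hN X1) -/Y0 -/Y1.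
  by rewrite !mulrA (aexpNV hN Y1) mul1r -!mulrA (aexpN hN Y0) mulr1.
have sN X : star X = X -> star (- X) = - X by rewrite starN => ->.
have sK : star (K 1) = exp (- Y0) * E * exp (- Y1).
  have sEN X : star X = X -> star (exp (- (2^-1 *: X))) = exp (- (2^-1 *: X)).
    by move=> sX; apply/sE/sN/sY.
  by rewrite KE !(starM hT) (sEN _ s0) (sEN _ s1) starB (sE _ s0) (sE _ s1) mulrA.
have KK : tr (star (K 1) * K 1) = tr (E * exp (- X1) * E * exp (- X0)).
  have halfN X : exp (- (2^-1 *: X)) * exp (- (2^-1 *: X)) = exp (- X).
    by rewrite -scalerN (aexp_half hN).
  rewrite sK KE -!mulrA (trC hT) -(halfN X0) -(halfN X1) -/Y0 -/Y1.
  by congr tr; rewrite -!mulrA.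
have := tr_cauchy_schwarz D (K 1); rewrite sD KK.
have DD0 : 0 <= tr (D * D) by have := tr_ge0 hT D; rewrite sD.
set e := tr (E * _ * _ * _) => cs.
have : tr (D * D) ^+ 2 <= tr (D * D) * e.
  by rewrite (le_trans _ cs) // lerXn2r ?nnegrE // (le_trans DD0).
rewrite expr2; have [->|Dn0] := eqVneq (tr (D * D)) 0.
  by move=> _; rewrite /e -KK (tr_ge0 hT).
by rewrite ler_pM2l // lt_def Dn0.
Qed.

End Tracial.

(** * Length of curves in a tracial algebra *)

Section Curves.
Context {R : realType} {B : algType R} {N : B -> R}.
Context (hN : complete_algebra_norm N).
Notation exp := (aexp N).
Notation tangent := (quadratic_tangent N).

(** Continuity of the inverse.  The identity [b i - b0 = - b i (a i - a0) b0]
    first bounds [b i] by [2 N b0], then gives convergence. *)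
Lemma acvg_inverse (I : Type) (F : set_system I) {FF : Filter F}
    (a b : I -> B) a0 b0 :
  N (a i - a0) @[i --> F] --> (0 : R) ->
  (\forall i \near F, b i * a i = 1) -> a0 * b0 = 1 ->
  N (b i - b0) @[i --> F] --> (0 : R).
Proof.
move=> aa0 ba ab0; have b00 := anorm_ge0 hN b0.
apply: (acvg_bound hN (v := fun i => 2 * N b0 ^+ 2 * N (a i - a0))).
  have e0 : 0 < (2 * (N b0 + 1))^-1 by rewrite invr_gt0; lra.
  have small : \forall i \near F, N (a i - a0) <= (2 * (N b0 + 1))^-1.
    have H : \forall i \near F, `|0 - N (a i - a0)| <= (2 * (N b0 + 1))^-1.
      exact: cvgr_dist_le aa0 _ e0.
    apply: filterS H => i.
    by rewrite sub0r normrN ger0_norm // (anorm_ge0 hN).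
  near=> i.
  have bai : b i * a i = 1 by near: i.
  have si : N (a i - a0) <= (2 * (N b0 + 1))^-1 by near: i.
  have dE : b i - b0 = - (b i * ((a i - a0) * b0)).
    by rewrite mulrBl ab0 mulrBr mulr1 mulrA bai mul1r opprB.
  have d0 := anorm_ge0 hN (a i - a0); have bi0 := anorm_ge0 hN (b i).
  have hd : N (b i - b0) <= N (b i) * (N (a i - a0) * N b0).
    rewrite dE (anormN hN) (le_trans (anormM hN _ _))// ler_wpM2l //.
    exact: (anormM hN).
  have hb := anorm_le_dist hN (b i) b0.
  have half : N (a i - a0) * N b0 <= 2^-1.
    have : N (a i - a0) * (N b0 + 1) <= 2^-1.
      by rewrite -ler_pdivlMr -?invfM //; lra.
    by rewrite mulrDr; lra.
  have bi : N (b i) <= 2 * N b0 by nra.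
  rewrite (le_trans hd)// expr2.
  have := mulr_ge0 d0 b00; nra.
rewrite [X in _ --> X](_ : _ = 2 * N b0 ^+ 2 * 0); last by rewrite mulr0.
by apply: cvgM => //; exact: cvg_cst.
Unshelve. all: by end_near. Qed.

Let near_dist_le1 (t : R) : \forall s \near t, `|s - t| <= 1.
Proof.
near=> s; rewrite distrC; near: s.
by apply: (@cvgr_dist_le _ _ _ _ _ id t) => //; exact: cvg_id.
Unshelve. all: by end_near. Qed.

Let dist_cvg0 (c t : R) : c * `|s - t| @[s --> t] --> (0 : R).
Proof.
rewrite -[X in _ --> X](_ : c * `|t - t| = 0); last by rewrite subrr normr0 mulr0.
apply: cvgM; first exact: cvg_cst.
by apply: cvg_norm; apply: cvgB; [exact: cvg_id|exact: cvg_cst].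
Qed.

Lemma tangent_cvg (A : set R) (F : R -> B) t D : tangent F t D ->
  N (F s - F t) @[s --> within A (nbhs t)] --> (0 : R).
Proof.
move=> /(tangent_bound hN)[C C0 HC].
apply: (acvg_bound hN (v := fun s => (N D + C) * `|s - t|)).
  apply: cvg_within; near=> s; have [|_ //] := HC s.
  by near: s; exact: near_dist_le1.
exact: cvg_within_filter (dist_cvg0 _ _).
Unshelve. all: by end_near. Qed.

Lemma tangent_derivative_cvg (A : set R) (F : R -> B) t D : tangent F t D ->
  N ((s - t)^-1 *: (F s - F t) - D) @[s --> within A t^'] --> (0 : R).
Proof.
move=> /(tangent_bound hN)[C C0 HC].
apply: (acvg_bound hN (v := fun s => C * `|s - t|)).
  apply: cvg_within; near=> s.
  have st : s - t != 0 by rewrite subr_eq0; near: s; exact: nbhs_dnbhs_neq.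
  have [|H _] := HC s; first by near: s; apply: nbhs_dnbhs; exact: near_dist_le1.
  have -> : (s - t)^-1 *: (F s - F t) - D
      = (s - t)^-1 *: (F s - F t - (s - t) *: D).
    by rewrite [RHS]scalerBr scalerA mulVf // scale1r.
  rewrite (anormZ hN) normfV ler_pdivrMl ?normr_gt0 // mulrCA.
  by rewrite -expr2.
apply: cvg_within_filter; exact: cvg_within_filter (dist_cvg0 _ _).
Unshelve. all: by end_near. Qed.

End Curves.

Section Length.
Context {R : realType} {B : algType R} {N : B -> R} {star : B -> B} {tr : B -> R}.
Context (hN : complete_algebra_norm N) (hT : tracial_involution N star tr).
Implicit Types (x y z g h X Y : B).
Notation exp := (aexp N).

Lemma inverse_unique x y z : y * x = 1 -> x * z = 1 -> y = z.
Proof. by move=> yx xz; rewrite -[y]mulr1 -xz mulrA yx mul1r. Qed.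

Lemma congruence_cancel g h x : g * h = 1 -> h * g = 1 ->
  g * (h * x * h) * g = x.
Proof. by move=> gh hg; rewrite -!mulrA hg mulr1 mulrA gh mul1r. Qed.

Lemma congruence_inverse g h x y : g * h = 1 -> h * g = 1 -> x * y = 1 ->
  (g * x * g) * (h * y * h) = 1.
Proof.
move=> gh hg xy; rewrite -!mulrA (mulrA g h) gh mul1r (mulrA x) xy mul1r.
exact: gh.
Qed.

(** Invariance of the metric under the congruence by [h], in the two-base-point
    form needed for finite differences. *)
Lemma tr_congruence g h x y z : g * h = 1 -> h * g = 1 ->
  tr (h * x * h * (g * y * g) * (h * x * h) * (g * z * g)) = tr (x * y * x * z).
Proof.
move=> gh hg; rewrite !mulrA (trC hT) !mulrA gh mul1r.
rewrite -[x * h * g]mulrA hg mulr1.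
rewrite -[x * y * g * h]mulrA gh mulr1.
by rewrite -[x * y * x * h * g]mulrA hg mulr1.
Qed.

Lemma acvg_tr (I : Type) (F : set_system I) {FF : Filter F} (u : I -> B) x :
  N (u i - x) @[i --> F] --> (0 : R) -> tr (u i) @[i --> F] --> tr x.
Proof.
move=> ux; apply/cvgrPdist_le => e e0; near=> i.
rewrite -(trB hT) (le_trans (tr_le hT _))// (anorm_distC hN).
have : `|0 - N (u i - x)| <= e by near: i; exact: cvgr_dist_le ux _ e0.
by rewrite sub0r normrN ger0_norm // (anorm_ge0 hN).
Unshelve. all: by end_near. Qed.

Definition trace_speed (c v : B) : R := Num.sqrt (tr (v * c * v * c)).

(** The logarithmic derivative of the curve is [g Y h], conjugate to [Y]. *)
Lemma trace_speed_geodesic g h Y (t : R) : g * h = 1 -> h * g = 1 ->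
  trace_speed (h * exp (- (t *: Y)) * h) (g * (exp (t *: Y) * Y) * g)
  = Num.sqrt (tr (Y * Y)).
Proof.
move=> gh hg; rewrite /trace_speed; set v := g * _ * g; set c := h * _ * h.
have cY : GRing.comm (exp (t *: Y)) Y.
  by apply: (aexp_comm hN); rewrite /GRing.comm -scalerAl -scalerAr.
have vc : v * c = g * Y * h.
  rewrite /v /c cY -!mulrA (mulrA g h) gh mul1r.
  by rewrite (mulrA (exp _)) (aexpN hN) mul1r.
rewrite -mulrA vc -!mulrA (mulrA h g) hg mul1r (trC hT).
by rewrite -!mulrA hg mulr1.
Qed.

Lemma cvg_trace_speed (I : Type) (F : set_system I) {FF : Filter F}
    (c c' v : I -> B) c0 v0 :
  N (c i - c0) @[i --> F] --> (0 : R) -> N (c' i - c0) @[i --> F] --> (0 : R) ->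
  N (v i - v0) @[i --> F] --> (0 : R) ->
  Num.sqrt (tr (v i * c i * v i * c' i)) @[i --> F] --> trace_speed c0 v0.
Proof.
move=> cc c'c vv; rewrite /trace_speed.
apply: continuous_cvg; first exact: sqrt_continuous.
by apply: acvg_tr; do 3! apply: acvgM => //.
Qed.

Section Curve.
Context (gamma gammai V : R -> B).
Let I01 : set R := `[0, 1].
Context (gammaVr : forall t : R, 0 <= t <= 1 -> gamma t * gammai t = 1)
  (gammaVl : forall t : R, 0 <= t <= 1 -> gammai t * gamma t = 1)
  (dgamma : forall t : R, 0 <= t <= 1 ->
     N ((s - t)^-1 *: (gamma s - gamma t) - V t) @[s --> within I01 t^'] --> (0 : R))
  (cV : forall t : R, 0 <= t <= 1 ->
     N (V s - V t) @[s --> within I01 (nbhs t)] --> (0 : R)).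

Let slope_cvg0 t : 0 <= t <= 1 ->
  N (gamma s - gamma t) @[s --> within I01 t^'] --> (0 : R).
Proof.
move=> t01; have dt := dgamma t01.
apply: (acvg_bound hN (v := fun s => `|s - t| *
   (N ((s - t)^-1 *: (gamma s - gamma t) - V t) + N (V t)))).
  apply: cvg_within; near=> s.
  have st : s - t != 0 by rewrite subr_eq0; near: s; exact: nbhs_dnbhs_neq.
  have {1}-> : gamma s - gamma t = (s - t) *: ((s - t)^-1 *: (gamma s - gamma t)).
    by rewrite scalerA mulfV // scale1r.
  rewrite (anormZ hN) ler_wpM2l //.
  by rewrite [leRHS]addrC (anorm_le_dist hN).
rewrite [X in _ --> X](_ : _ = `|t - t| * (0 + N (V t))); last first.
  by rewrite subrr normr0 mul0r.
apply: cvgM; last by apply: cvgD => //; exact: cvg_cst.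
apply: cvg_within_filter; apply: cvg_within_filter; apply: cvg_norm.
by apply: cvgB; [exact: cvg_id|exact: cvg_cst].
Unshelve. all: by end_near. Qed.

Let inverse_slope_cvg0 t : 0 <= t <= 1 ->
  N (gammai s - gammai t) @[s --> within I01 t^'] --> (0 : R).
Proof.
move=> t01; apply: (acvg_inverse hN (slope_cvg0 t01)); last exact: gammaVr.
by rewrite near_withinE; near=> s; rewrite /I01 /= in_itv /= => ?; exact: gammaVl.
Unshelve. all: by end_near. Qed.

(** At [s = t] itself nothing is to be shown, so the punctured limit extends. *)
Let inverse_cvg t : 0 <= t <= 1 ->
  N (gammai s - gammai t) @[s --> within I01 (nbhs t)] --> (0 : R).
Proof.
move=> t01; apply/cvgrPdist_le => e e0; rewrite near_withinE.
have : \forall s \near within I01 t^', `|0 - N (gammai s - gammai t)| <= e.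
  exact: cvgr_dist_le (inverse_slope_cvg0 t01) _ e0.
rewrite near_withinE /dnbhs near_withinE; apply: filterS => s Hs Is.
have [->|st] := eqVneq s t; last exact: Hs.
by rewrite subrr (anorm0 hN) subr0 normr0 ltW.
Qed.

Let speed t := trace_speed (gammai t) (V t).

Lemma continuous_trace_speed : {within I01, continuous speed}.
Proof.
apply/subspace_continuousP => t; rewrite /I01 /= in_itv /= => t01.
apply: cvg_trace_speed; [exact: inverse_cvg|exact: inverse_cvg|exact: cV].
Qed.

Context (g h : B) (gh : g * h = 1) (hg : h * g = 1).
Context (L : R -> B)
  (sL : forall t : R, 0 <= t <= 1 -> star (L t) = L t)
  (eL : forall t : R, 0 <= t <= 1 -> exp (L t) = h * gamma t * h).

Let exp_NL t : 0 <= t <= 1 -> exp (- L t) = g * gammai t * g.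
Proof.
move=> t01; apply: (@inverse_unique (exp (L t))); first exact: aexpNV.
by rewrite eL // congruence_inverse // gammaVr.
Qed.

Lemma log_increment_le s t : 0 <= s <= 1 -> 0 <= t <= 1 ->
  tr ((L s - L t) * (L s - L t)) <=
  tr ((gamma s - gamma t) * gammai s * (gamma s - gamma t) * gammai t).
Proof.
move=> s01 t01.
have := tr_log_difference_le hN hT (sL t01) (sL s01).
rewrite !eL // !exp_NL // -mulrBl -mulrBr tr_congruence //.
Qed.

(** A lower bound of the length by the trace distance between logarithms of the
    end points.  The logarithm [L t] is any selfadjoint one, chosen separately
    for every [t]; testing it against the total increment [Y] gives a real
    function to which the growth comparison applies. *)
Lemma log_length_le :
  ((Num.sqrt (tr ((L 1 - L 0) * (L 1 - L 0))))%:E <=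
   \int[lebesgue_measure]_(t in `[0%R, 1%R]) (speed t)%:E)%E.
Proof.
have in0 : 0 <= (0 : R) <= 1 by lra.
have in1 : 0 <= (1 : R) <= 1 by lra.
pose Y := L 1 - L 0; rewrite -/Y; pose y := Num.sqrt (tr (Y * Y)).
have sY : star Y = Y by rewrite (starB hT) !sL.
have YY0 : 0 <= tr (Y * Y) by have := tr_ge0 hT Y; rewrite sY.
have [y0|yn0] := eqVneq y 0.
  rewrite -/y y0; apply: integral_ge0 => t _; rewrite lee_fin; exact: sqrtr_ge0.
have yp : 0 < y by rewrite lt_def yn0 sqrtr_ge0.
have y2 : y ^+ 2 = tr (Y * Y) by rewrite sqr_sqrtr.
pose f t := tr (Y * L t) / y.
have -> : Num.sqrt (tr (Y * Y)) = f 1 - f 0.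
  by rewrite -/y /f -mulrBl -(trB hT) -mulrBr -/Y -y2 expr2 mulfK.
apply: increment_le_integral; first exact: continuous_trace_speed.
move=> t e t01 e0.
pose q s := (s - t)^-1 *: (gamma s - gamma t).
pose c s := Num.sqrt (tr (q s * gammai s * q s * gammai t)).
have qc : c s @[s --> within I01 t^'] --> speed t.
  apply: cvg_trace_speed; [exact: inverse_slope_cvg0| |exact: dgamma].
  by rewrite subrr (anorm0 hN); exact: cvg_cst.
have : \forall s \near within I01 t^', `|speed t - c s| <= e.
  exact: cvgr_dist_le qc _ e0.
rewrite near_withinE /dnbhs near_withinE => /nbhs_ballP[d /= d0 Hd].
exists d => // s s01 std.
have [->|st] := eqVneq s t; first by rewrite !subrr !normr0 mulr0.
have st0 : s - t != 0 by rewrite subr_eq0.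
have cs : c s <= speed t + e.
  have := Hd s; rewrite -ball_normE /= distrC => /(_ std st).
  rewrite /I01 /= in_itv /= => /(_ s01); rewrite distrC ler_norml; lra.
have flip : f s - f t = tr (star Y * (L s - L t)) / y.
  by rewrite /f -mulrBl -(trB hT) -mulrBr sY.
have D0 : 0 <= tr ((L s - L t) * (L s - L t)).
  by have := tr_ge0 hT (L s - L t); rewrite (starB hT) !sL.
have f1 : `|f s - f t| <= Num.sqrt (tr ((L s - L t) * (L s - L t))).
  rewrite flip normrM normfV (gtr0_norm yp) ler_pdivrMr // mulrC.
  rewrite -sqrtrM // -sqrtr_sqr ler_wsqrtr //.
  have := tr_cauchy_schwarz hT Y (L s - L t).
  by rewrite (starB hT) !sL // sY.
rewrite (le_trans f1)//.
apply: (@le_trans _ _ (c s * `|s - t|)); last by rewrite ler_wpM2r.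
have dE : gamma s - gamma t = (s - t) *: q s by rewrite /q scalerA mulfV ?scale1r.
have -> : c s * `|s - t| = Num.sqrt
    (tr ((gamma s - gamma t) * gammai s * (gamma s - gamma t) * gammai t)).
  rewrite /c dE; move: (q s) => Q.
  rewrite -!(scalerAl, scalerAr) !(trZ hT) mulrA -expr2.
  by rewrite sqrtrM ?sqr_ge0 // sqrtr_sqr mulrC.
by rewrite ler_wsqrtr // log_increment_le.
Qed.

End Curve.
End Length.

(** * Bounded operators *)

Section BoundedOperators.
Context {R : realType} {H : completeNormedModType R[i]}.
Implicit Types (S T : H -> H) (x y : H).

(** The norm of the Hilbert space takes its values in [R[i]]; its real part
    carries the same information and lives where the estimates are made. *)
Definition rnorm x : R := complex.Re `|x|.

Lemma rnormE x : `|x| = (rnorm x)%:C.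
Proof. by rewrite RRe_real // ger0_real. Qed.

Lemma rnorm_ge0 x : 0 <= rnorm x.
Proof. by rewrite -ler0c -rnormE. Qed.

Lemma rnormD x y : rnorm (x + y) <= rnorm x + rnorm y.
Proof. by rewrite -lecR rmorphD /= -!rnormE ler_normD. Qed.

Lemma rnormZ (k : R) x : rnorm (k%:C *: x) = `|k| * rnorm x.
Proof.
apply: complexI; rewrite -rnormE normrZ rmorphM /= -rnormE; congr (_ * _).
by rewrite normc_def /= expr0n addr0 sqrtr_sqr.
Qed.

Lemma rnormN x : rnorm (- x) = rnorm x.
Proof. by rewrite /rnorm normrN. Qed.

Lemma rnorm0 : rnorm (0 : H) = 0.
Proof. by rewrite /rnorm normr0. Qed.

Lemma rnorm_eq0 x : rnorm x = 0 -> x = 0.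
Proof. by move=> x0; apply/eqP; rewrite -normr_eq0 rnormE x0. Qed.

Lemma bounded_opP T : bounded_op T <->
  linear T /\ exists M : R, forall x, rnorm (T x) <= M * rnorm x.
Proof.
by split=> -[lT [M HM]]; split=> //; exists M => x; have := HM x;
   rewrite !rnormE -rmorphM lecR.
Qed.

Lemma linear_op0 T : linear T -> T 0 = 0.
Proof. by move=> lT; have := lT (-1) 0 0; rewrite scaler0 addr0 scaleN1r addNr. Qed.

Lemma linear_opD T x y : linear T -> T (x + y) = T x + T y.
Proof. by move=> lT; have := lT 1 x y; rewrite !scale1r. Qed.

Lemma linear_opZ T c x : linear T -> T (c *: x) = c *: T x.
Proof. by move=> lT; have := lT c x 0; rewrite !addr0 (linear_op0 lT) addr0. Qed.

Lemma linear_opB T x y : linear T -> T (x - y) = T x - T y.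
Proof.
by move=> lT; rewrite (linear_opD _ _ lT) -scaleN1r (linear_opZ _ _ lT) scaleN1r.
Qed.

Let unit_values T := [set complex.Re `|T x| | x in [set x : H | `|x| <= 1]].

Lemma opnorm_has_sup T : bounded_op T -> has_sup (unit_values T).
Proof.
move=> /bounded_opP[lT [M HM]]; split.
  by exists (rnorm (T 0)); exists 0 => //=; rewrite normr0.
exists (Num.max M 0) => _ [x /= x1 <-].
have {}x1 : rnorm x <= 1 by rewrite -lecR -rnormE.
rewrite (le_trans (HM x))// (@le_trans _ _ (Num.max M 0 * rnorm x)) //.
  by rewrite ler_wpM2r ?rnorm_ge0 // le_max lexx.
by rewrite ler_piMr // le_max lexx orbT.
Qed.

Lemma le_opnorm T x : bounded_op T -> rnorm (T x) <= opnorm T * rnorm x.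
Proof.
move=> bT; have [lT _] := bT; have [x0|x0] := eqVneq (rnorm x) 0.
  by rewrite (rnorm_eq0 x0) (linear_op0 lT) rnorm0 mulr0.
have xp : 0 < rnorm x by rewrite lt_def x0 rnorm_ge0.
rewrite -ler_pdivrMr // mulrC.
rewrite -[X in X * _]ger0_norm ?invr_ge0 ?rnorm_ge0 // -rnormZ -(linear_opZ _ _ lT).
apply: ub_le_sup; first exact: (opnorm_has_sup bT).2.
exists ((rnorm x)^-1%:C *: x) => //=.
by rewrite rnormE rnormZ ger0_norm ?invr_ge0 ?rnorm_ge0 // mulVf.
Qed.

Lemma opnorm_le T (M : R) : 0 <= M -> (forall x, rnorm (T x) <= M * rnorm x) ->
  opnorm T <= M.
Proof.
move=> M0 HM; apply: ge_sup.
  by exists (rnorm (T 0)); exists 0 => //=; rewrite normr0.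
move=> _ [x /= x1 <-]; have {}x1 : rnorm x <= 1 by rewrite -lecR -rnormE.
by rewrite (le_trans (HM x))// ler_piMr.
Qed.

Lemma opnorm_ge0 T : bounded_op T -> 0 <= opnorm T.
Proof.
move=> bT; apply: le_trans (rnorm_ge0 (T 0)) _.
apply: ub_le_sup; first exact: (opnorm_has_sup bT).2.
by exists 0 => //=; rewrite normr0.
Qed.

Lemma bounded_id : bounded_op (@id H).
Proof. by apply/bounded_opP; split=> //; exists 1 => x; rewrite mul1r. Qed.

Lemma bounded_comp S T : bounded_op S -> bounded_op T -> bounded_op (S \o T).
Proof.
move=> bS bT; apply/bounded_opP; split.
  by move=> c x y /=; rewrite bT.1 bS.1.
exists (opnorm S * opnorm T) => x /=.
by rewrite (le_trans (le_opnorm _ bS))// -mulrA ler_wpM2l ?opnorm_ge0 // le_opnorm.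
Qed.

Lemma bounded_add S T : bounded_op S -> bounded_op T -> bounded_op (S + T).
Proof.
move=> bS bT; apply/bounded_opP; split.
  by move=> c x y; rewrite !fctE bS.1 bT.1 scalerDr addrACA.
exists (opnorm S + opnorm T) => x.
by rewrite fctE (le_trans (rnormD _ _))// mulrDl lerD ?le_opnorm.
Qed.

Lemma rnormZc (c : R[i]) x : rnorm (c *: x) = complex.Re `|c| * rnorm x.
Proof.
apply: complexI; rewrite -rnormE normrZ rmorphM /= -rnormE; congr (_ * _).
Qed.

Lemma bounded_scale (c : R[i]) T : bounded_op T -> bounded_op (c *: T).
Proof.
move=> bT; apply/bounded_opP; split.
  by move=> d x y; rewrite !fctE bT.1 scalerDr !scalerA mulrC.
exists (complex.Re `|c| * opnorm T) => x.
rewrite fctE rnormZc -mulrA ler_wpM2l ?le_opnorm //.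
by rewrite -ler0c RRe_real // ger0_real.
Qed.

Lemma bounded_sub S T : bounded_op S -> bounded_op T -> bounded_op (S - T).
Proof. by move=> bS bT; rewrite -scaleN1r; apply/bounded_add/bounded_scale. Qed.

Lemma opnormD S T : bounded_op S -> bounded_op T ->
  opnorm (S + T) <= opnorm S + opnorm T.
Proof.
move=> bS bT; apply: opnorm_le; first by rewrite addr_ge0 ?opnorm_ge0.
move=> x; by rewrite fctE (le_trans (rnormD _ _))// mulrDl lerD ?le_opnorm.
Qed.

Lemma opnormM S T : bounded_op S -> bounded_op T ->
  opnorm (S \o T) <= opnorm S * opnorm T.
Proof.
move=> bS bT; apply: opnorm_le; first by rewrite mulr_ge0 ?opnorm_ge0.
move=> x /=.
by rewrite (le_trans (le_opnorm _ bS))// -mulrA ler_wpM2l ?opnorm_ge0 // le_opnorm.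
Qed.

Lemma opnorm1 : opnorm (@id H) <= 1.
Proof. by apply: opnorm_le => // x; rewrite mul1r. Qed.

Lemma opnormZ (k : R) T : bounded_op T -> opnorm (k%:C *: T) = `|k| * opnorm T.
Proof.
move=> bT.
have le c S : bounded_op S -> opnorm (c%:C *: S) <= `|c| * opnorm S.
  move=> bS; apply: opnorm_le; first by rewrite mulr_ge0 ?opnorm_ge0.
  by move=> x; rewrite fctE rnormZ -mulrA ler_wpM2l ?le_opnorm.
apply/eqP; rewrite eq_le le //=.
have [->|k0] := eqVneq k 0.
  by rewrite normr0 mul0r opnorm_ge0 //; exact: bounded_scale.
have kk : k^-1%:C *: (k%:C *: T) = T by rewrite scalerA -rmorphM mulVf // scale1r.
rewrite -{1}kk -ler_pdivlMl ?normr_gt0 // -normfV.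
by apply: le; exact: bounded_scale.
Qed.

Lemma opnorm_eq0 T : bounded_op T -> opnorm T = 0 -> T = 0.
Proof.
move=> bT T0; apply/funext => x; apply: rnorm_eq0.
by apply/eqP; rewrite eq_le rnorm_ge0 andbT; have := le_opnorm x bT; rewrite T0 mul0r.
Qed.

Lemma op_cvg_unique (I : Type) (F : set_system I) {FF : ProperFilter F}
    (u : I -> H -> H) S T :
  (forall i, bounded_op (u i)) -> bounded_op S -> bounded_op T ->
  op_cvg F u S -> op_cvg F u T -> S = T.
Proof.
move=> bu bS bT uS uT; have bST := bounded_sub bS bT.
apply/eqP; rewrite -subr_eq0; apply/eqP/(opnorm_eq0 bST)/eqP.
rewrite eq_le (opnorm_ge0 bST) andbT.
have h : opnorm (u i - S) + opnorm (u i - T) @[i --> F] --> (0 : R).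
  by rewrite -[0]addr0; exact: cvgD.
apply: cvgr_to_ge h _; near=> i.
have bi := bu i; have biS := bounded_sub bi bS; have biT := bounded_sub bi bT.
have -> : S - T = (-1 : R)%:C *: (u i - S) + (u i - T).
  by rewrite rmorphN rmorph1 scaleN1r opprB addrA subrK.
rewrite (le_trans (opnormD _ _))//; first exact: bounded_scale.
by rewrite opnormZ // normrN1 mul1r.
Unshelve. all: by end_near. Qed.

End BoundedOperators.

(** * Adjoints on a Hilbert space *)

Section HilbertSpace.
Context {R : realType} {H : completeNormedModType R[i]} {ip : {dot H for Num.conj}}.
Context (hH : is_hilbert_norm ip).
Implicit Types (S T : H -> H) (x y u v : H).

Definition rip x y : R := complex.Re (ip x y).

Lemma ip_conj x y : ip y x = conjc (ip x y).
Proof. by rewrite hermC /= expr0 mul1r. Qed.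

Lemma ripC x y : rip x y = rip y x.
Proof. by rewrite /rip (ip_conj y x); case: (ip y x). Qed.

Lemma ripDl x y u : rip (x + y) u = rip x u + rip y u.
Proof. by rewrite /rip linearDl raddfD. Qed.

Lemma ripZl (k : R) x u : rip (k%:C *: x) u = k * rip x u.
Proof.
rewrite /rip linearZl_LR /=; case: (ip x u) => a b /=.
by rewrite mul0r subr0.
Qed.

Lemma ripNl x u : rip (- x) u = - rip x u.
Proof. by rewrite -scaleN1r -(rmorphN1 (real_complex R)) ripZl mulN1r. Qed.

Lemma ripBl x y u : rip (x - y) u = rip x u - rip y u.
Proof. by rewrite ripDl ripNl. Qed.

Lemma ripBr x y u : rip u (x - y) = rip u x - rip u y.
Proof. by rewrite !(ripC u) ripBl. Qed.

Lemma ripZr (k : R) x u : rip u (k%:C *: x) = k * rip u x.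
Proof. by rewrite !(ripC u) ripZl. Qed.

Lemma ip_normE x : ip x x = (rnorm x ^+ 2)%:C.
Proof. by rewrite -hH rnormE -rmorphXn. Qed.

Lemma ripE x : rip x x = rnorm x ^+ 2.
Proof. by rewrite /rip ip_normE. Qed.

Lemma rip_le x y : rip x y <= rnorm x * rnorm y.
Proof.
have cs : rip x y ^+ 2 <= rip x x * rip y y.
  apply: quadratic_discriminant_le => [|r]; first by rewrite ripE sqr_ge0.
  have : 0 <= rip (x - r%:C *: y) (x - r%:C *: y) by rewrite ripE sqr_ge0.
  rewrite ripBl !ripBr !ripZl !ripZr (ripC y x); congr (0 <= _); ring.
rewrite -[rnorm x * _]ger0_norm ?mulr_ge0 ?rnorm_ge0 //.
rewrite (le_trans (ler_norm _)) // -[X in X <= _]sqrtr_sqr -[X in _ <= X]sqrtr_sqr.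
by rewrite ler_wsqrtr // exprMn -!ripE.
Qed.

Lemma is_adjoint_sym S T : is_adjoint ip S T -> is_adjoint ip T S.
Proof. by move=> ST x y; rewrite [LHS]ip_conj -ST -ip_conj. Qed.

Lemma is_adjoint_unique S T T' : is_adjoint ip S T -> is_adjoint ip S T' -> T = T'.
Proof.
move=> ST ST'; apply/funext => y; apply/eqP; rewrite -subr_eq0; apply/eqP.
apply: rnorm_eq0; apply/eqP; rewrite -sqrf_eq0 -ripE ripBr.
by rewrite {1}/rip -ST ST' subrr.
Qed.

Lemma is_adjoint_id : is_adjoint ip id id.
Proof. by []. Qed.

Lemma is_adjoint_comp S S' T T' : is_adjoint ip S S' -> is_adjoint ip T T' ->
  is_adjoint ip (S \o T) (T' \o S').
Proof. by move=> hS hT x y /=; rewrite hS hT. Qed.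

Lemma is_adjoint_add S S' T T' : is_adjoint ip S S' -> is_adjoint ip T T' ->
  is_adjoint ip (S + T) (S' + T').
Proof. by move=> hS hT x y; rewrite !fctE linearDl linearDr /= hS hT. Qed.

Lemma is_adjoint_scale (c : R[i]) S S' : is_adjoint ip S S' ->
  is_adjoint ip (c *: S) (conjc c *: S').
Proof.
move=> hS x y; rewrite !fctE linearZl_LR linearZr_LR /= hS; congr (_ * _).
exact/esym/conjcK.
Qed.

(** From [|T y|^2 = <S (T y), y> <= |S| |T y| |y|]. *)
Lemma adjoint_opnorm_le S T : bounded_op S -> bounded_op T -> is_adjoint ip S T ->
  opnorm T <= opnorm S.
Proof.
move=> bS bT ST; apply: opnorm_le; first exact: opnorm_ge0.
move=> y; have [->|Ty0] := eqVneq (rnorm (T y)) 0.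
  by rewrite mulr_ge0 ?rnorm_ge0 ?opnorm_ge0.
have Typ : 0 < rnorm (T y) by rewrite lt_def Ty0 rnorm_ge0.
rewrite -(ler_pM2l Typ) -expr2 -ripE {1}/rip -ST.
rewrite -[leLHS]/(rip (S (T y)) y) (le_trans (rip_le _ _))//.
by rewrite mulrCA mulrA ler_wpM2r ?rnorm_ge0 // le_opnorm.
Qed.

Lemma adjoint_comp_positive S T : is_adjoint ip S T -> positive_op ip (T \o S).
Proof.
move=> /is_adjoint_sym ST x /=; rewrite ST ip_normE ler0c sqr_ge0 //.
Qed.

(** Polarization: the values at [x + y] and at [x + i y] are real, which gives
    the imaginary and the real part of the claim. *)
Lemma positive_selfadjoint T : linear T -> positive_op ip T -> is_adjoint ip T T.
Proof.
move=> lT pT x y.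
rewrite [RHS]ip_conj.
have im0 z : complex.Im (ip (T z) z) = 0 by exact: ger0_Im (pT z).
have h1 := im0 (x + y); have h2 := im0 (x + 'i%C *: y).
move: h1 h2; rewrite !(linear_opD _ _ lT) (linear_opZ _ _ lT).
rewrite !linearDl !linearDr /= !linearZl_LR !linearZr_LR /=.
have := im0 x; have := im0 y.
case: (ip (T x) x) => a1 a2; case: (ip (T y) y) => b1 b2.
case: (ip (T x) y) => c1 c2; case: (ip (T y) x) => d1 d2 /=.
by move=> -> -> h1 h2; congr (Complex _ _); lra.
Qed.

End HilbertSpace.

(** * A von Neumann algebra as a tracial normed algebra *)

Section Closure.
Context {R : realType} {H : completeNormedModType R[i]} {ip : {dot H for Num.conj}}.
Context {A : set (H -> H)} (hA : von_neumann_algebra ip A).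
Implicit Types (S T : H -> H).

Lemma vna_of_commutes T : bounded_op T ->
  (forall S, commutant A S -> T \o S = S \o T) -> A T.
Proof. by move=> bT cT; rewrite -(vn_bicommutant hA). Qed.

Lemma vna_commutes T S : A T -> commutant A S -> T \o S = S \o T.
Proof. by rewrite -{1}(vn_bicommutant hA) => -[_]; exact. Qed.

Lemma vna_id : A id.
Proof. by apply: vna_of_commutes => //; exact: bounded_id. Qed.

Lemma vna_comp S T : A S -> A T -> A (S \o T).
Proof.
move=> AS AT; apply: vna_of_commutes.
  by apply: bounded_comp; exact: (vn_bounded hA).
move=> U cU; rewrite -[LHS]/(S \o (T \o U)) (vna_commutes AT cU).
by rewrite -[LHS]/((S \o U) \o T) (vna_commutes AS cU).
Qed.

Lemma vna_add S T : A S -> A T -> A (S + T).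
Proof.
move=> AS AT; apply: vna_of_commutes.
  by apply: bounded_add; exact: (vn_bounded hA).
move=> U cU; apply/funext => x; have lU := cU.1.1.
rewrite /= !fctE (linear_opD _ _ lU).
by rewrite -[S (U x)]/((S \o U) x) -[T (U x)]/((T \o U) x) (vna_commutes AS cU) (vna_commutes AT cU).
Qed.

Lemma vna_scale (c : R[i]) T : A T -> A (c *: T).
Proof.
move=> AT; apply: vna_of_commutes.
  by apply: bounded_scale; exact: (vn_bounded hA).
move=> U cU; apply/funext => x; have lU := cU.1.1.
rewrite /= !fctE (linear_opZ _ _ lU).
by rewrite -[T (U x)]/((T \o U) x) (vna_commutes AT cU).
Qed.

Lemma vna_zero : A 0.
Proof. by rewrite -(scale0r (@id H)); apply: vna_scale; exact: vna_id. Qed.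

Lemma vna_opp T : A T -> A (- T).
Proof. by rewrite -scaleN1r; exact: vna_scale. Qed.

(** Commutation with every element of the commutant passes to limits in operator
    norm. *)
Lemma vna_limit T : bounded_op T ->
  (forall e : R, 0 < e -> exists2 S, A S & opnorm (S - T) <= e) -> A T.
Proof.
move=> bT lim; apply: vna_of_commutes => // U cU; have bU := cU.1.
apply/eqP; rewrite -subr_eq0; apply/eqP/funext => x; apply: rnorm_eq0.
apply/eqP; rewrite eq_le rnorm_ge0 andbT.
apply/ler_addgt0Pr => e e0; rewrite add0r.
pose K := rnorm (U x) + opnorm U * rnorm x + 1.
have K0 : 0 < K.
  by rewrite ltr_pwDr // addr_ge0 ?rnorm_ge0 // mulr_ge0 ?rnorm_ge0 ?opnorm_ge0.
have [S AS Se] := lim (e / K) (divr_gt0 e0 K0).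
have bS := vn_bounded hA AS; have bST := bounded_sub bS bT.
have -> : ((T \o U) - (U \o T)) x = U ((S - T) x) - (S - T) (U x).
  rewrite !fctE /= (linear_opB _ _ bU.1).
  rewrite -[S (U x)]/((S \o U) x) (vna_commutes AS cU) /= opprB [RHS]addrC.
  by rewrite addrA subrK.
rewrite (le_trans (rnormD _ _))// rnormN.
have h1 := le_opnorm (U x) bST; have h2 := le_opnorm x bST.
have h3 := le_opnorm ((S - T) x) bU.
have dK : e / K * K = e by rewrite divfK // gt_eqF.
have h4 : opnorm U * rnorm ((S - T) x) <= opnorm U * (e / K * rnorm x).
  rewrite ler_wpM2l ?opnorm_ge0 // (le_trans h2)// ler_wpM2r ?rnorm_ge0 //.
have h5 : rnorm ((S - T) (U x)) <= e / K * rnorm (U x).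
  by rewrite (le_trans h1)// ler_wpM2r ?rnorm_ge0.
have eK0 : 0 < e / K by rewrite divr_gt0.
have : e / K * K = e / K * rnorm (U x) + opnorm U * (e / K * rnorm x) + e / K.
  by rewrite /K; ring.
rewrite dK; lra.
Qed.

End Closure.

(** The elements of [A] as a type, so that they can carry a ring structure.  The
    two proofs are parameters because the closure of [A] under the operations
    rests on the first and [1 != 0] on the second. *)
Definition vna (R : realType) (H : completeNormedModType R[i])
    (ip : {dot H for Num.conj}) (A : set (H -> H)) (tau : (H -> H) -> R[i])
    of von_neumann_algebra ip A & finite_normal_faithful_trace ip A tau : Type :=
  {T : H -> H | A T}.

Section Algebra.
Context {R : realType} {H : completeNormedModType R[i]} {ip : {dot H for Num.conj}}.
Context {A : set (H -> H)} {tau : (H -> H) -> R[i]}.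
Context (hA : von_neumann_algebra ip A) (htau : finite_normal_faithful_trace ip A tau).
Local Notation V := (vna hA htau).

Lemma vna_inj (x y : V) : sval x = sval y -> x = y.
Proof. by case: x y => [S AS] [T AT] /= ST; exact: eq_exist. Qed.

HB.instance Definition _ := gen_eqMixin V.
HB.instance Definition _ := gen_choiceMixin V.

Definition vadd (x y : V) : V := exist _ _ (vna_add hA (svalP x) (svalP y)).
Definition vopp (x : V) : V := exist _ _ (vna_opp hA (svalP x)).
Definition vzero : V := exist _ _ (vna_zero hA).
Definition vone : V := exist _ _ (vna_id hA).
Definition vmul (x y : V) : V := exist _ _ (vna_comp hA (svalP x) (svalP y)).
(** Only real scalars act: the exponential calculus and the metric are real. *)
Definition vscale (k : R) (x : V) : V := exist _ _ (vna_scale hA k%:C (svalP x)).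

Fact vaddA : associative vadd.
Proof. by move=> x y z; apply: vna_inj; rewrite /= addrA. Qed.
Fact vaddC : commutative vadd.
Proof. by move=> x y; apply: vna_inj; rewrite /= addrC. Qed.
Fact vadd0 : left_id vzero vadd.
Proof. by move=> x; apply: vna_inj; rewrite /= add0r. Qed.
Fact vaddN : left_inverse vzero vopp vadd.
Proof. by move=> x; apply: vna_inj; rewrite /= addNr. Qed.
HB.instance Definition _ := GRing.isZmodule.Build V vaddA vaddC vadd0 vaddN.

Let vlin (x : V) : linear (sval x) := (vn_bounded hA (svalP x)).1.

Fact vmulA : associative vmul.
Proof. by move=> x y z; apply: vna_inj. Qed.
Fact vmul1 : left_id vone vmul.
Proof. by move=> x; apply: vna_inj. Qed.
Fact vmulr1 : right_id vone vmul.
Proof. by move=> x; apply: vna_inj. Qed.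
Fact vmulDl : left_distributive vmul +%R.
Proof. by move=> x y z; apply: vna_inj. Qed.
Fact vmulDr : right_distributive vmul +%R.
Proof.
move=> x y z; apply: vna_inj; apply/funext => u /=.
exact: (linear_opD _ _ (vlin x)).
Qed.
(** The trace takes the value [1] at the identity. *)
Fact vone_neq0 : vone != 0.
Proof.
apply/eqP => /(congr1 (fun x : V => tau (sval x))) /=.
rewrite (trace_state htau) => t0.
have := trace_linear htau (-1) (vna_zero hA) (vna_zero hA).
rewrite scaler0 addr0 mulN1r addNr -t0 => /eqP; by rewrite oner_eq0.
Qed.
HB.instance Definition _ := GRing.Zmodule_isNzRing.Build V
  vmulA vmul1 vmulr1 vmulDl vmulDr vone_neq0.

Fact vscaleA a b (x : V) : vscale a (vscale b x) = vscale (a * b) x.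
Proof. by apply: vna_inj; rewrite /= scalerA rmorphM. Qed.
Fact vscale1 : left_id 1 vscale.
Proof. by move=> x; apply: vna_inj; rewrite /= scale1r. Qed.
Fact vscaleDr : right_distributive vscale +%R.
Proof. by move=> a x y; apply: vna_inj; rewrite /= scalerDr. Qed.
Fact vscaleDl (x : V) : {morph vscale^~ x : a b / a + b}.
Proof. by move=> a b; apply: vna_inj; rewrite /= rmorphD scalerDl. Qed.
HB.instance Definition _ := GRing.Zmodule_isLmodule.Build R V
  vscaleA vscale1 vscaleDr vscaleDl.

Fact vscaleAl (a : R) (x y : V) : a *: (x * y) = (a *: x) * y.
Proof. by apply: vna_inj. Qed.
HB.instance Definition _ := GRing.Lmodule_isLalgebra.Build R V vscaleAl.

Fact vscaleAr (a : R) (x y : V) : a *: (x * y) = x * (a *: y).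
Proof.
apply: vna_inj; apply/funext => u /=.
by rewrite !fctE (linear_opZ _ _ (vlin x)).
Qed.
HB.instance Definition _ := GRing.Lalgebra_isAlgebra.Build R V vscaleAr.

Lemma sval_sum (I : Type) (r : seq I) (P : pred I) (F : I -> V) :
  sval (\sum_(i <- r | P i) F i) = \sum_(i <- r | P i) sval (F i).
Proof. by elim/big_rec2 : _ => // i y1 y2 _ <-. Qed.

Lemma svalX (x : V) k : sval (x ^+ k) = iter k (sval x).
Proof.
elim: k => [|k IH]; first by apply/funext.
by rewrite exprS; apply/funext => u /=; rewrite IH.
Qed.

End Algebra.

Section VNA.
Context {R : realType} {H : completeNormedModType R[i]} {ip : {dot H for Num.conj}}.
Context (hH : is_hilbert_norm ip).
Context {A : set (H -> H)} {tau : (H -> H) -> R[i]}.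
Context (hA : von_neumann_algebra ip A) (htau : finite_normal_faithful_trace ip A tau).
Local Notation V := (vna hA htau).
Implicit Types (x y : V).

Definition vnorm x : R := opnorm (sval x).

Lemma vna_bounded x : bounded_op (sval x).
Proof. exact: vn_bounded hA _ (svalP x). Qed.

(** A Cauchy sequence converges at every vector; the pointwise limit is linear,
    the convergence is uniform on the unit ball, and the limit is again in the
    algebra because the algebra is closed in operator norm. *)
Lemma vnorm_complete (u : nat -> V) :
  (forall e, 0 < e -> exists n, forall m, (n <= m)%N -> vnorm (u m - u n) <= e) ->
  exists l, vnorm (u n - l) @[n --> \oo] --> (0 : R).
Proof.
move=> cu.
have cux e : 0 < e -> exists n, forall m, (n <= m)%N -> forall x : H,
    rnorm (sval (u m) x - sval (u n) x) <= e * rnorm x.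
  move=> e0; have [n Hn] := cu e e0; exists n => m nm x.
  rewrite (le_trans (le_opnorm x (vna_bounded (u m - u n))))//.
  by rewrite ler_wpM2r ?rnorm_ge0 // Hn.
have ptw (x : H) : cvg (sval (u n) x @[n --> \oo]).
  apply/cauchy_cvgP/cauchy_exP => e e0.
  have eE : e = (complex.Re e)%:C by rewrite RRe_real // gtr0_real.
  have e'0 : 0 < complex.Re e by rewrite -ltcR -eE.
  have K0 : 0 < rnorm x + 1 by rewrite ltr_wpDl ?rnorm_ge0.
  have [n Hn] := cux (complex.Re e / (rnorm x + 1)) (divr_gt0 e'0 K0).
  exists (sval (u n) x); exists n => // m /= nm.
  rewrite -ball_normE /= distrC eE rnormE ltcR.
  rewrite (le_lt_trans (Hn m nm x))// mulrAC ltr_pdivrMr // ltr_pM2l //.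
  by rewrite ltrDl.
pose L (x : H) := lim (sval (u n) x @[n --> \oo]).
have uL (x : H) : sval (u n) x @[n --> \oo] --> L x by exact: ptw.
have bnd e : 0 < e -> exists n, forall m, (n <= m)%N -> forall x : H,
    rnorm (sval (u m) x - L x) <= e * rnorm x.
  move=> e0; have [n Hn] := cux (e / 2) (divr_gt0 e0 (ltr0n _ 2)).
  exists n => m nm x; apply/ler_addgt0Pr => d d0.
  have d0' : 0 < d%:C :> R[i] by rewrite ltcR.
  have [k _ Hk] := cvgr_dist_le _ _ (uL x) _ d0'.
  pose j := maxn n k.
  have h1 := Hk j (leq_maxr _ _); rewrite /= distrC rnormE lecR in h1.
  have h2 := Hn j (leq_maxl _ _) x.
  have h3 := Hn m nm x.
  have -> : sval (u m) x - L x = (sval (u m) x - sval (u n) x)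
      - (sval (u j) x - sval (u n) x) + (sval (u j) x - L x).
    by rewrite opprB !addrA !subrK.
  rewrite (le_trans (rnormD _ _))// lerD // (le_trans (rnormD _ _))// rnormN.
  lra.
have lL : linear L.
  move=> c x y; have uxy := uL (c *: x + y).
  have h : c *: sval (u n) x + sval (u n) y @[n --> \oo] --> c *: L x + L y.
    by apply: cvgD; [exact: (cvgZr (uL x))|exact: uL].
  apply: (cvg_unique (@norm_hausdorff _ _) uxy).
  apply: cvg_trans h; apply: near_eq_cvg; near=> n.
  by rewrite (vna_bounded (u n)).1.
have bL : bounded_op L.
  apply/bounded_opP; split=> //; have [n Hn] := bnd 1 ltr01.
  exists (1 + vnorm (u n)) => x.
  have -> : L x = - (sval (u n) x - L x) + sval (u n) x by rewrite opprB subrK.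
  rewrite (le_trans (rnormD _ _))// rnormN mulrDl lerD ?Hn //.
  exact: (le_opnorm _ (vna_bounded _)).
have bndN e : 0 < e -> exists n, forall m, (n <= m)%N -> opnorm (sval (u m) - L) <= e.
  move=> e0; have [n Hn] := bnd e e0; exists n => m nm.
  by apply: opnorm_le => [|x]; [exact: ltW|exact: Hn].
have AL : A L.
  apply: (vna_limit hA bL) => e e0; have [n Hn] := bndN e e0.
  by exists (sval (u n)); [exact: svalP|exact: Hn].
exists (exist _ L AL); apply/cvgrPdist_le => e e0.
have [n Hn] := bndN e e0; exists n => // m /= nm.
rewrite sub0r normrN ger0_norm; first exact: Hn.
by apply: opnorm_ge0; exact: vna_bounded.
Unshelve. all: by end_near. Qed.

Lemma vna_complete_norm : complete_algebra_norm vnorm.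
Proof.
split.
- by move=> x y; apply: opnormD; exact: vna_bounded.
- by move=> a x; apply: opnormZ; exact: vna_bounded.
- by move=> x /(opnorm_eq0 (vna_bounded x)) x0; exact: vna_inj.
- by move=> x y; apply: opnormM; exact: vna_bounded.
- exact: opnorm1.
- exact: vnorm_complete.
Qed.

Lemma vadjoint_subproof x : {y : V | is_adjoint ip (sval x) (sval y)}.
Proof.
apply: cid; have [S AS xS] := vn_adjoint hA (svalP x).
by exists (exist _ S AS).
Qed.

Definition vadjoint x : V := sval (vadjoint_subproof x).

Lemma vadjointP x : is_adjoint ip (sval x) (sval (vadjoint x)).
Proof. exact: (svalP (vadjoint_subproof x)). Qed.

Lemma vadjoint_eq x y : is_adjoint ip (sval x) (sval y) -> vadjoint x = y.
Proof.
by move=> xy; apply: vna_inj; exact: (is_adjoint_unique hH (vadjointP x)).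
Qed.

Definition vtrace x : R := complex.Re (tau (sval x)).

Lemma vtraceD x y : vtrace (x + y) = vtrace x + vtrace y.
Proof.
have := trace_linear htau 1 (svalP x) (svalP y).
by rewrite scale1r mul1r /vtrace /= => ->; rewrite raddfD.
Qed.

Lemma vtraceZ a x : vtrace (a *: x) = a * vtrace x.
Proof.
have t0 : tau 0 = 0.
  have := trace_linear htau 1 (vna_zero hA) (vna_zero hA).
  by rewrite scale1r mul1r addr0 => /eqP; rewrite -subr_eq subrr eq_sym => /eqP.
have := trace_linear htau a%:C (svalP x) (vna_zero hA).
rewrite addr0 t0 addr0 /vtrace /= => ->.
by case: (tau (sval x)) => p q /=; rewrite mul0r subr0.
Qed.

Lemma vtrace_adjoint_ge0 x : 0 <= vtrace (vadjoint x * x).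
Proof.
have : 0 <= tau (sval (vadjoint x * x)).
  apply: (trace_ge0 htau (svalP _)).
  exact: (adjoint_comp_positive hH (vadjointP x)).
by rewrite lecE => /andP[_].
Qed.

(** The trace of [(1 + i T)* (1 + i T)] is real; its imaginary part is
    the difference of the two real parts. *)
Lemma vtrace_adjoint x : vtrace (vadjoint x) = vtrace x.
Proof.
pose T := sval x; pose T' := sval (vadjoint x).
have AT : A T := svalP x; have AT' : A T' := svalP (vadjoint x).
have lT' : linear T' := (vna_bounded (vadjoint x)).1.
pose S := 'i%C *: T + id; pose S' := (- 'i%C) *: T' + id.
have AS : A S by apply: (vna_add hA); [exact: (vna_scale hA)|exact: (vna_id hA)].
have AS' : A S' by apply: (vna_add hA); [exact: (vna_scale hA)|exact: (vna_id hA)].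
have SS' : is_adjoint ip S S'.
  apply: is_adjoint_add; last exact: is_adjoint_id.
  have -> : - 'i%C = conjc 'i%C :> R[i] by apply/eqP; rewrite eq_complex /= oppr0 !eqxx.
  by apply: is_adjoint_scale; exact: vadjointP.
have := trace_ge0 htau (vna_comp hA AS' AS) (adjoint_comp_positive hH SS').
have -> : S' \o S = 'i%C *: T + ((- 'i%C) *: T' + ((T' \o T) + id)).
  apply/funext => u; rewrite /S /S' /= !fctE.
  rewrite (linear_opD _ _ lT') (linear_opZ _ _ lT').
  rewrite scalerDr scalerA.
  have -> : - 'i%C * 'i%C = 1 :> R[i] by rewrite mulNr -expr2 sqr_i opprK.
  rewrite scale1r -/T' -/T.
  by rewrite !addrA [LHS](ACl (3*2*1*4)).
have AT'T : A (T' \o T) by exact: (vna_comp hA).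
have A1 : A id by exact: (vna_id hA).
have AA : A ((T' \o T) + id) by exact: (vna_add hA).
have AB : A ((- 'i%C) *: T' + ((T' \o T) + id)) by apply: (vna_add hA) => //; exact: (vna_scale hA).
rewrite (trace_linear htau _ AT AB) (trace_linear htau _ AT' AA).
have := trace_linear htau 1 AT'T A1; rewrite scale1r mul1r => ->.
have TT : 0 <= tau (T' \o T).
  by apply: (trace_ge0 htau) => //; exact: (adjoint_comp_positive hH (vadjointP x)).
move=> /ger0_Im; rewrite (trace_state htau); move: (ger0_Im TT).
rewrite /vtrace -/T -/T'.
case: (tau T) => a b; case: (tau T') => c d; case: (tau _) => e f /= ->.
lra.
Qed.

Lemma vadjointD x y : vadjoint (x + y) = vadjoint x + vadjoint y.
Proof. by apply: vadjoint_eq; apply: is_adjoint_add; exact: vadjointP. Qed.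

Lemma vadjointZ (a : R) x : vadjoint (a *: x) = a *: vadjoint x.
Proof.
apply: vadjoint_eq; rewrite /= -[in X in is_adjoint _ _ X](conjc_real a).
by apply: is_adjoint_scale; exact: vadjointP.
Qed.

(** With [c] the norm of [x], positivity on [(c - x)* (c - x)] and on
    [c^2 - x* x] gives [2 c tr x <= 2 c^2]. *)
Lemma vtrace_le_pos x : vtrace x <= vnorm x.
Proof.
have N0 : 0 <= vnorm x by exact: (opnorm_ge0 (vna_bounded x)).
have [N00|Nn0] := eqVneq (vnorm x) 0.
  have -> : x = 0 by apply: (anorm_eq0 vna_complete_norm).
  by rewrite -(scale0r (0 : V)) vtraceZ mul0r; exact: (opnorm_ge0 (vna_bounded _)).
have Np : 0 < vnorm x by rewrite lt_def Nn0.
set c := vnorm x in N0 Np *.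
have tN y : vtrace (- y) = - vtrace y by rewrite -scaleN1r vtraceZ mulN1r.
have t1 : vtrace 1 = 1 by rewrite /vtrace /= (trace_state htau).
have a1 : vadjoint 1 = 1 by apply: vadjoint_eq; exact: is_adjoint_id.
have aN y : vadjoint (- y) = - vadjoint y by rewrite -scaleN1r vadjointZ scaleN1r.
have := vtrace_adjoint_ge0 (c *: 1 - x).
rewrite vadjointD vadjointZ a1 aN.
rewrite mulrBl !mulrBr -!scalerAl !mul1r -scalerAr mulr1.
rewrite !(vtraceD, tN, vtraceZ) t1 vtrace_adjoint.
have : vtrace (vadjoint x * x) <= c * c.
  rewrite -subr_ge0 -[X in X - _]mulr1 -t1 -vtraceZ -tN -vtraceD.
  have AP : A (sval ((c * c) *: 1 - vadjoint x * x)) by exact: svalP.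
  have : 0 <= tau (sval ((c * c) *: 1 - vadjoint x * x)).
    apply: (trace_ge0 htau AP) => u.
    rewrite /= !fctE linearBl /= linearZl_LR /=.
    rewrite (is_adjoint_sym (vadjointP x)) !(ip_normE hH) -rmorphM -rmorphB ler0c.
    rewrite subr_ge0 -expr2 -exprMn lerXn2r ?nnegrE ?rnorm_ge0 ?mulr_ge0 ?rnorm_ge0 //.
    exact: (le_opnorm _ (vna_bounded x)).
  by rewrite lecE => /andP[_].
nra.
Qed.

Lemma vna_tracial : tracial_involution vnorm vadjoint vtrace.
Proof.
split.
- exact: vadjointD.
- exact: vadjointZ.
- by move=> x y; apply: vadjoint_eq; apply: is_adjoint_comp; exact: vadjointP.
- by move=> x; apply: vadjoint_eq; apply: is_adjoint_sym; exact: vadjointP.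
- by move=> x; apply: (adjoint_opnorm_le hH) (vadjointP x); exact: vna_bounded.
- exact: vtraceD.
- exact: vtraceZ.
- by move=> x y; rewrite /vtrace /= (trace_comm htau (svalP x) (svalP y)).
- exact: vtrace_adjoint.
- exact: vtrace_adjoint_ge0.
- move=> x; rewrite ler_norml vtrace_le_pos andbT lerNl.
  rewrite -(anormN vna_complete_norm) -mulN1r -vtraceZ scaleN1r.
  exact: vtrace_le_pos.
Qed.

End VNA.

(** * Logarithms of positive invertible operators *)

Section Calculus.
Context {R : realType} {H : completeNormedModType R[i]} {ip : {dot H for Num.conj}}.
Context (hH : is_hilbert_norm ip).
Context {A : set (H -> H)} {tau : (H -> H) -> R[i]}.
Context (hA : von_neumann_algebra ip A) (htau : finite_normal_faithful_trace ip A tau).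
Local Notation V := (vna hA htau).
Local Notation exp := (aexp (vnorm (hA := hA) (htau := htau))).
Implicit Types (x y X : V).
Let hN := vna_complete_norm hA htau.
Let hT := vna_tracial hH hA htau.

Lemma sval_exp_partial x n : sval (exp_partial x n) =
  \sum_(0 <= k < n) (k`!%:R : R[i])^-1 *: iter k (sval x).
Proof.
rewrite sval_sum; apply: eq_bigr => k _ /=.
by rewrite svalX fmorphV rmorph_nat.
Qed.

Lemma expop_sval x : expop (sval x) = sval (exp x).
Proof.
rewrite /expop; set P := [set E | _].
have PE : P (sval (exp x)).
  split; first exact: vna_bounded.
  have := aexp_cvg hN x; apply: cvg_trans; apply: near_eq_cvg; near=> n.
  by rewrite -sval_exp_partial.
have [bE cE] := getPex (ex_intro _ _ PE).
apply: (op_cvg_unique _ bE (vna_bounded (exp x)) cE PE.2) => n.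
by rewrite -sval_exp_partial; exact: vna_bounded.
Unshelve. all: by end_near. Qed.

Lemma opinv_sval x y : x * y = 1 -> y * x = 1 -> opinv (sval x) = sval y.
Proof.
move=> xy yx; rewrite /opinv; set P := [set S | _].
have Py : P (sval y).
  by split; [exact: (congr1 sval xy)|exact: (congr1 sval yx)].
have [h1 h2] := getPex (ex_intro _ _ Py).
apply/funext => u; have := congr1 (fun f => get P (f u)) Py.1.
by rewrite /= -[get P (sval x _)]/((get P \o sval x) _) h2.
Qed.

Lemma SigmaP c : Sigma ip A c ->
  exists x y, [/\ sval x = c, positive_op ip c, x * y = 1 & y * x = 1].
Proof.
move=> [Ac pc [d [Ad cd dc]]].
exists (exist _ c Ac), (exist _ d Ad); split=> //; exact: vna_inj.
Qed.

Lemma Sigma_sval x y : positive_op ip (sval x) -> x * y = 1 -> y * x = 1 ->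
  Sigma ip A (sval x).
Proof.
move=> px xy yx; split=> //; first exact: svalP.
exists (sval y); split; [exact: svalP|exact: (congr1 sval xy)|exact: (congr1 sval yx)].
Qed.

(** The inequality [c^2 <= M c] for a positive [c] of norm at most [M], obtained
    from the positivity of [<c v, v>] at [v = M u - c u]. *)
Lemma positive_norm_le c (M : R) x : bounded_op c -> positive_op ip c -> 0 < M ->
  opnorm c <= M -> forall u, rnorm (c u) ^+ 2 <= M * rip (ip := ip) (c u) u.
Proof.
move=> bc pc M0 cM u.
have sc := positive_selfadjoint bc.1 pc.
have rsc v w : rip (ip := ip) (c v) w = rip (ip := ip) v (c w) by rewrite /rip sc.
have pos v : 0 <= rip (ip := ip) (c v) v by have := pc v; rewrite lecE => /andP[_].
have h1 : rip (ip := ip) (c (c u)) (c u) <= M * rnorm (c u) ^+ 2.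
  rewrite (le_trans (rip_le hH _ _))// expr2 mulrA ler_wpM2r ?rnorm_ge0 //.
  by rewrite (le_trans (le_opnorm _ bc))// ler_wpM2r ?rnorm_ge0.
have := pos (M%:C *: u - c u).
rewrite (linear_opB _ _ bc.1) (linear_opZ _ _ bc.1).
rewrite !ripBl !ripBr !ripZl !ripZr (rsc (c u) u) => h2.
rewrite -(ripE hH) in h1 *.
have : 0 <= M * (M * rip (ip := ip) (c u) u - rip (ip := ip) (c u) (c u)) by nra.
by rewrite pmulr_rge0 // subr_ge0.
Qed.

(** With [M] a bound of [x] and [K] of its inverse,
    [|u - x u / M|^2 <= |u|^2 - |x u|^2 / M^2 <= (1 - 1 / (K M)^2) |u|^2]. *)
Lemma contraction_of_positive x y : positive_op ip (sval x) -> y * x = 1 ->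
  exists2 M, 0 < M & vnorm (1 - M^-1 *: x) < 1.
Proof.
move=> px yx.
(* adding [1] makes both bounds at least [1], so that [w <= 1] below *)
pose M := vnorm x + 1; pose K := vnorm y + 1.
have x0 : 0 <= vnorm x by exact: (opnorm_ge0 (vna_bounded x)).
have y0 : 0 <= vnorm y by exact: (opnorm_ge0 (vna_bounded y)).
have M1 : 1 <= M by rewrite /M; lra.
have K1 : 1 <= K by rewrite /K; lra.
have M0 : 0 < M by lra.
have K0 : 0 < K by lra.
pose w := ((K * M) ^+ 2)^-1.
have w0 : 0 < w by rewrite invr_gt0 exprn_gt0 // mulr_gt0.
have w1 : w <= 1 by rewrite invf_le1 ?exprn_gt0 ?mulr_gt0 // exprn_ege1 // mulr_ege1.
(* [1 - w / 2] is an upper bound of the square root of [1 - w] *)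
exists M => //; apply: (@le_lt_trans _ _ (1 - w / 2)); last by lra.
apply: opnorm_le => [|u]; first by lra.
rewrite -[leLHS]ger0_norm ?rnorm_ge0 // -[leRHS]ger0_norm; last first.
  by rewrite mulr_ge0 ?rnorm_ge0 //; lra.
rewrite -!sqrtr_sqr ler_wsqrtr //.
have cu : rnorm (sval x u) ^+ 2 <= M * rip (ip := ip) (sval x u) u.
  by apply: positive_norm_le => //; [exact: vna_bounded|rewrite /M /vnorm; lra].
have uK : rnorm u <= K * rnorm (sval x u).
  have {1}-> : u = sval y (sval x u) by rewrite -[RHS]/(sval (y * x) u) yx.
  rewrite (le_trans (le_opnorm _ (vna_bounded y)))// ler_wpM2r ?rnorm_ge0 //.
  by rewrite /K /vnorm; lra.
have uK2 : w * rnorm u ^+ 2 <= M^-1 ^+ 2 * rnorm (sval x u) ^+ 2.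
  have -> : M^-1 ^+ 2 * rnorm (sval x u) ^+ 2 = w * (K * rnorm (sval x u)) ^+ 2.
    by rewrite /w; field; rewrite !gt_eqF.
  rewrite ler_wpM2l ?(ltW w0) // lerXn2r ?nnegrE ?rnorm_ge0 //.
  by rewrite mulr_ge0 ?rnorm_ge0 // ltW.
have uE : rnorm (sval (1 - M^-1 *: x) u) ^+ 2 =
    rnorm u ^+ 2 - 2 * M^-1 * rip (ip := ip) (sval x u) u
    + M^-1 ^+ 2 * rnorm (sval x u) ^+ 2.
  rewrite -!(ripE hH) /= !fctE ripBl !ripBr !ripZl !ripZr (ripC u).
  by ring.
have cu' : M^-1 ^+ 2 * rnorm (sval x u) ^+ 2 <= M^-1 * rip (ip := ip) (sval x u) u.
  rewrite expr2 -mulrA ler_wpM2l ?invr_ge0 ?(ltW M0) // ler_pdivrMl //.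
have := sqr_ge0 (w * rnorm u); rewrite uE !exprMn; nra.
Qed.

(** [x = M (1 - u)] with [u] of norm less than one, and [1 - u] is the
    exponential of minus the sum of the logarithmic series at [u]. *)
Lemma exists_log x y : positive_op ip (sval x) -> y * x = 1 ->
  exists X, vadjoint X = X /\ exp X = x.
Proof.
move=> px yx; have [M M0 uM] := contraction_of_positive px yx.
have [L [uL eL]] := log_series hN uM.
have sx : vadjoint x = x.
  by apply: (vadjoint_eq hH); apply: positive_selfadjoint => //; exact: (vna_bounded x).1.
have su : vadjoint (1 - M^-1 *: x) = 1 - M^-1 *: x.
  by rewrite (starB hT) (star1 hT) (starZ hT) sx.
have sL : vadjoint L = L.
  by apply: (acvg_star_fixed hN hT uL) => n; exact: (star_log_partial hT).
exists (ln M *: 1 - L); split.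
  by rewrite (starB hT) (starZ hT) (star1 hT) sL.
rewrite (aexpD_comm hN); last first.
  by rewrite /GRing.comm mulrN mulNr -scalerAl -scalerAr mul1r mulr1.
rewrite (aexp_scalar hN) lnK ?posrE // -scalerAl mul1r.
move: eL; rewrite opprB addrC subrK => eL.
rewrite -[exp (- L)]mulr1 -eL mulrA (aexpNV hN) mul1r scalerA mulfV ?scale1r //.
by rewrite gt_eqF.
Qed.

(** Existence of a logarithm is enough for the choice operator to return one. *)
Lemma logopP c : Sigma ip A c -> exists X,
  [/\ vadjoint X = X, sval (exp X) = c & logop ip A c = sval X].
Proof.
move=> /SigmaP[x [y [xc pc xy yx]]]; rewrite -xc in pc *.
have [X [sX eX]] := exists_log pc yx.
rewrite /logop; set P := [set z | _].
have PX : P (sval X).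
  split; last by rewrite expop_sval eX.
  by split; [exact: svalP|have := vadjointP X; rewrite sX].
have [[AZ sZ] eZ] := getPex (ex_intro _ _ PX).
exists (exist _ (get P) AZ); split=> //.
  exact: (vadjoint_eq hH).
by rewrite -expop_sval.
Qed.

Lemma powopP c : Sigma ip A c -> exists X,
  [/\ vadjoint X = X, sval (exp X) = c &
      forall t, powop ip A c t = sval (exp (t *: X))].
Proof.
move=> /logopP[X [sX eX lX]]; exists X; split=> // t.
by rewrite /powop lX -expop_sval.
Qed.

Lemma positive_conj x g : vadjoint g = g -> positive_op ip (sval x) ->
  positive_op ip (sval (g * x * g)).
Proof.
move=> sg px u; have := vadjointP g; rewrite sg => ag.
by rewrite /= ag; exact: px.
Qed.

Lemma exp_positive X : vadjoint X = X -> positive_op ip (sval (exp X)).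
Proof.
move=> sX; rewrite -(aexp_half hN X).
have sE : vadjoint (exp (2^-1 *: X)) = exp (2^-1 *: X).
  by apply: (star_exp hN hT); rewrite (starZ hT) sX.
have := vadjointP (exp (2^-1 *: X)); rewrite sE => aE.
exact: (adjoint_comp_positive hH aE).
Qed.

End Calculus.

(** * Geodesics *)

Lemma within_unit_dnbhs_proper (R : realType) (t : R) : 0 <= t <= 1 ->
  ProperFilter (within (`[0, 1] : set R) t^').
Proof.
move=> t01; apply: Build_ProperFilter_ex => P Pt.
have /nbhs_ballP[d /= d0 Hd] : \forall s \near t, s != t -> `[0, 1]%classic s -> P s.
  exact: Pt.
pose k := Num.min (d / 2) (1 / 2).
have k0 : 0 < k by rewrite lt_min !divr_gt0.
have kd : k < d by rewrite gt_min; apply/orP; left; lra.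
have k2 : k <= 1 / 2 by rewrite ge_min lexx orbT.
exists (if t <= 1 / 2 then t + k else t - k).
apply: Hd.
- rewrite -ball_normE /=; case: ifP => _; rewrite ltr_norml; lra.
- by apply/eqP; case: ifP => _ e; lra.
- by rewrite /= in_itv /=; case: ifPn => h; lra.
Qed.

Section Final.
Context {R : realType} {H : completeNormedModType R[i]} {ip : {dot H for Num.conj}}.
Context (hH : is_hilbert_norm ip).
Context {A : set (H -> H)} {tau : (H -> H) -> R[i]}.
Context (hA : von_neumann_algebra ip A) (htau : finite_normal_faithful_trace ip A tau).
Local Notation V := (vna hA htau).
Local Notation N := (vnorm (hA := hA) (htau := htau)).
Local Notation exp := (aexp N).
Implicit Types (x y X Y D g h : V).
Let hN := vna_complete_norm hA htau.
Let hT := vna_tracial hH hA htau.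
Let I01 : set R := `[0, 1].

(** A curve is constrained on the unit interval only; outside, or wherever the
    value is not in [A], the junk value [0] is used. *)
Definition vlift (T : H -> H) : V :=
  if pselect (A T) is left AT then exist _ T AT else 0.

Lemma vliftK T : A T -> sval (vlift T) = T.
Proof. by rewrite /vlift; case: pselect. Qed.

Lemma velocity_sval (c : R -> V) t D : 0 <= t <= 1 ->
  N ((s - t)^-1 *: (c s - c t) - D) @[s --> within I01 t^'] --> (0 : R) ->
  is_op_derivative (fun s => sval (c s)) t (sval D) /\
  velocity (fun s => sval (c s)) t = sval D.
Proof.
move=> t01 cD.
have dD : is_op_derivative (fun s => sval (c s)) t (sval D).
  by split; [exact: vna_bounded|exact: cD].
split=> //; rewrite /velocity; set P := [set E | _].
have [bE cE] := getPex (ex_intro P _ dD).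
have PF := within_unit_dnbhs_proper t01.
apply: (op_cvg_unique _ bE (vna_bounded D) cE cD) => s.
exact: vna_bounded ((s - t)^-1 *: (c s - c t)).
Qed.

(** The difference quotients lie in [A], which is closed in operator norm. *)
Lemma op_derivative_mem (gamma : R -> H -> H) (t : R) (D : H -> H) : 0 <= t <= 1 ->
  (forall s, 0 <= s <= 1 -> A (gamma s)) -> is_op_derivative gamma t D -> A D.
Proof.
move=> t01 Ag [bD cD]; apply: (vna_limit hA bD) => e e0.
have PF := within_unit_dnbhs_proper t01.
have small : \forall s \near within I01 t^',
    `|0 - opnorm (((s - t)^-1)%:C *: (gamma s - gamma t) - D)| <= e.
  exact: cvgr_dist_le cD _ e0.
have in01 : \forall s \near within I01 t^', 0 <= s <= 1.
  by rewrite near_withinE; near=> s; rewrite /I01 /= in_itv.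
near (within I01 t^') => s.
have s01 : 0 <= s <= 1 by near: s.
have Aq : A (((s - t)^-1)%:C *: (gamma s - gamma t)).
  by apply/(vna_scale hA)/(vna_add hA); [exact: Ag|apply: (vna_opp hA); exact: Ag].
exists (((s - t)^-1)%:C *: (gamma s - gamma t)) => //.
have : `|0 - opnorm (((s - t)^-1)%:C *: (gamma s - gamma t) - D)| <= e by near: s.
rewrite sub0r normrN; apply: le_trans; exact: ler_norm.
Unshelve. all: by end_near. Qed.

Section Geodesic.
Context (a b : H -> H) (ha : Sigma ip A a) (hb : Sigma ip A b).

(** The powers of [a] with exponents [1/2] and [- 1/2] are mutually inverse
    exponentials [g] and [h], and [Y] is the logarithm of [h b h]. *)
Lemma geodesicP : exists g h Y,
  [/\ vadjoint g = g, vadjoint Y = Y, g * h = 1, h * g = 1 &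
   [/\ sval (g * g) = a, sval (g * exp Y * g) = b &
      forall t, geodesic ip A a b t = sval (g * exp (t *: Y) * g)]].
Proof.
have [X [sX eX pX]] := powopP hH hA htau ha.
have sE (k : R) : vadjoint (exp (k *: X)) = exp (k *: X).
  by apply: (star_exp hN hT); rewrite (starZ hT) sX.
have [g [h [[sg sh gh hg] [gE hE gg]]]] : exists g h,
    [/\ vadjoint g = g, vadjoint h = h, g * h = 1 & h * g = 1] /\
    [/\ exp ((1 / 2) *: X) = g, exp ((- (1 / 2)) *: X) = h & g * g = exp X].
  exists (exp ((1 / 2) *: X)), (exp ((- (1 / 2)) *: X)).
  split; split; [exact: sE|exact: sE| | |by []|by []|].
  - by rewrite scaleNr (aexpN hN).
  - by rewrite scaleNr (aexpNV hN).
  - by rewrite div1r (aexp_half hN).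
have [B [B' [Bb pB BB' B'B]]] := SigmaP hA htau hb.
have SB : Sigma ip A (sval (h * B * h)).
  apply: (@Sigma_sval _ _ _ _ _ _ _ _ (g * B' * g)).
  - by apply: (positive_conj sh); rewrite Bb; exact: pB.
  - exact: congruence_inverse.
  - exact: congruence_inverse.
have [Y [sY eY pY]] := powopP hH hA htau SB.
exists g, h, Y; split; [exact: sg|exact: sY|exact: gh|exact: hg|split].
- by rewrite gg.
- have -> : exp Y = h * B * h by exact: vna_inj.
  by rewrite (congruence_cancel _ gh hg).
- move=> t; rewrite /geodesic !pX gE hE -Bb.
  by rewrite -[X in powop _ _ X]/(sval (h * B * h)) pY.
Qed.

End Geodesic.

Section ExplicitGeodesic.
Context (g h Y : V) (sg : vadjoint g = g) (sY : vadjoint Y = Y)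
  (gh : g * h = 1) (hg : h * g = 1).

Let delta (t : R) : V := g * exp (t *: Y) * g.
Let delta' (t : R) : V := g * (exp (t *: Y) * Y) * g.
Let deltai (t : R) : V := h * exp (- (t *: Y)) * h.

Let deltaV t : delta t * deltai t = 1.
Proof. by apply: congruence_inverse => //; exact: (aexpN hN). Qed.

Let deltaVl t : deltai t * delta t = 1.
Proof. by apply: congruence_inverse => //; exact: (aexpNV hN). Qed.

Let tangent_delta t : quadratic_tangent N delta t (delta' t).
Proof.
exact: (tangent_congruence hN g (tangent_expZ hN Y t)).
Qed.

Let tangent_delta' t : exists D, quadratic_tangent N delta' t D.
Proof.
eexists; apply: (tangent_congruence hN g).
exact: (tangentM hN (tangent_expZ hN Y t) (tangent_cst hN Y t)).
Qed.

Let velocity_delta t : 0 <= t <= 1 ->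
  is_op_derivative (fun s => sval (delta s)) t (sval (delta' t)) /\
  velocity (fun s => sval (delta s)) t = sval (delta' t).
Proof.
by move=> t01; apply: velocity_sval => //; exact: (tangent_derivative_cvg hN).
Qed.

Lemma explicit_geodesic_smooth : smooth_curve ip A (fun t => sval (delta t)).
Proof.
move=> t; rewrite in_itv /= => t01; have [dt vt] := velocity_delta t01; split.
- apply: (Sigma_sval _ (deltaV t) (deltaVl t)).
  by apply: (positive_conj sg); apply: (exp_positive hH); rewrite (starZ hT) sY.
- by exists (sval (delta' t)).
- have [D tD] := tangent_delta' t.
  have := tangent_cvg hN I01 tD; apply: cvg_trans; apply: near_eq_cvg.
  rewrite near_withinE; near=> s; rewrite /= in_itv /= => s01.
  by rewrite vt (velocity_delta s01).2.
Unshelve. all: by end_near. Qed.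

Lemma explicit_geodesic_length :
  curve_length tau (fun t => sval (delta t)) = (Num.sqrt (vtrace (Y * Y)))%:E.
Proof.
rewrite /curve_length.
rewrite (eq_integral (cst (Num.sqrt (vtrace (Y * Y)))%:E)); last first.
  move=> t; rewrite inE /= in_itv /= => t01.
  have [_ vt] := velocity_delta t01.
  rewrite vt /metric_norm /metric (opinv_sval (deltaV t) (deltaVl t)).
  by have := trace_speed_geodesic hN hT Y t gh hg; rewrite /trace_speed => <-.
rewrite integral_cst //= lebesgue_measure_itv /= lte_fin ltr01.
by rewrite oppr0 adde0 mule1.
Qed.

(** The logarithm along the curve is prescribed at the end points, [0] and [Y],
    so that its increment is [Y] without appealing to uniqueness. *)
Lemma explicit_geodesic_shortest (gamma : R -> H -> H) :
  smooth_curve ip A gamma -> gamma 0 = sval (g * g) ->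
  gamma 1 = sval (g * exp Y * g) ->
  ((Num.sqrt (vtrace (Y * Y)))%:E <= curve_length tau gamma)%E.
Proof.
move=> sgam gam0 gam1.
have sgam' t : 0 <= t <= 1 -> [/\ Sigma ip A (gamma t),
    exists E, is_op_derivative gamma t E &
    op_cvg (within I01 (nbhs t)) (velocity gamma) (velocity gamma t)].
  by move=> t01; apply: sgam; rewrite in_itv.
pose c t := vlift (gamma t); pose ci t := vlift (opinv (gamma t)).
pose v t := vlift (velocity gamma t).
have Agam t : 0 <= t <= 1 -> A (gamma t).
  by move=> t01; have [[]] := sgam' t t01.
have cE t : 0 <= t <= 1 -> sval (c t) = gamma t by move=> t01; rewrite vliftK //; exact: Agam.
have dgam t : 0 <= t <= 1 -> is_op_derivative gamma t (velocity gamma t).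
  by move=> t01; have [_ exD _] := sgam' t t01; exact: (getPex exD).
have vE t : 0 <= t <= 1 -> sval (v t) = velocity gamma t.
  by move=> t01; rewrite vliftK //; exact: (op_derivative_mem t01 Agam (dgam t t01)).
have inv t : 0 <= t <= 1 ->
    [/\ positive_op ip (sval (c t)), sval (ci t) = opinv (gamma t),
        c t * ci t = 1 & ci t * c t = 1].
  move=> t01; have [/(SigmaP hA htau)[x [y [xE px xy yx]]] _ _] := sgam' t t01.
  have -> : c t = x by apply: vna_inj; rewrite cE.
  have -> : ci t = y.
    apply: vna_inj; rewrite vliftK -?xE (opinv_sval xy yx) //; exact: svalP.
  by rewrite -xE (opinv_sval xy yx) xE.
pose L t : V := if t == 0 then 0 else if t == 1 then Y else
  xget 0 [set X | vadjoint X = X /\ exp X = h * c t * h].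
have sh : vadjoint h = h.
  apply: (inverse_unique (x := g)); last exact: gh.
  by rewrite -sg -(starM hT) gh (star1 hT).
have LP t : 0 <= t <= 1 -> vadjoint (L t) = L t /\ exp (L t) = h * c t * h.
  move=> t01; rewrite /L; have [->|t0] := eqVneq t 0.
    have -> : c 0 = g * g by apply: vna_inj; rewrite cE ?gam0 // lexx ler01.
    by rewrite (star0 hT) (aexp0 hN) mulrA hg mul1r gh.
  have [->|t1] := eqVneq t 1.
    have -> : c 1 = g * exp Y * g by apply: vna_inj; rewrite cE ?gam1 // lexx ler01.
    by rewrite (congruence_cancel _ hg gh).
  have [pc _ cci cic] := inv t t01.
  apply: (@xgetPex _ 0 [set X | vadjoint X = X /\ exp X = h * c t * h]).
  apply: (exists_log hH (y := g * ci t * g)); first exact: (positive_conj sh).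
  exact: congruence_inverse.
have dc t : 0 <= t <= 1 ->
    N ((s - t)^-1 *: (c s - c t) - v t) @[s --> within I01 t^'] --> (0 : R).
  move=> t01; have [_ cD] := dgam t t01; apply: cvg_trans cD; apply: near_eq_cvg.
  rewrite near_withinE; near=> s; rewrite /I01 /= in_itv /= => s01.
  by rewrite /vnorm /= !cE // vE.
have cv t : 0 <= t <= 1 -> N (v s - v t) @[s --> within I01 (nbhs t)] --> (0 : R).
  move=> t01; have [_ _ cD] := sgam' t t01; apply: cvg_trans cD; apply: near_eq_cvg.
  rewrite near_withinE; near=> s; rewrite /I01 /= in_itv /= => s01.
  by rewrite /vnorm /= !vE.
have c1 t : 0 <= t <= 1 -> c t * ci t = 1 by move=> /inv[].
have c2 t : 0 <= t <= 1 -> ci t * c t = 1 by move=> /inv[].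
have l1 t : 0 <= t <= 1 -> vadjoint (L t) = L t by move=> /LP[].
have l2 t : 0 <= t <= 1 -> exp (L t) = h * c t * h by move=> /LP[].
have := log_length_le hN hT c1 c2 dc cv gh hg l1 l2.
have -> : L 1 - L 0 = Y by rewrite /L oner_eq0 !eqxx subr0.
move=> /le_trans; apply; rewrite le_eqVlt; apply/orP; left; apply/eqP.
apply: eq_integral => t; rewrite inE /= in_itv /= => t01.
have [_ ciE _ _] := inv t t01.
by rewrite /trace_speed /metric_norm /metric -ciE -vE.
Unshelve. all: by end_near. Qed.

End ExplicitGeodesic.
End Final.

Theorem theorem3p1 (R : realType) (H : completeNormedModType R[i])
    (ip : {dot H for Num.conj}) (hH : is_hilbert_norm ip)
    (A : set (H -> H)) (hA : von_neumann_algebra ip A)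
    (tau : (H -> H) -> R[i]) (htau : finite_normal_faithful_trace ip A tau)
    (a b : H -> H) (ha : Sigma ip A a) (hb : Sigma ip A b) :
  [/\ smooth_curve ip A (geodesic ip A a b),
      geodesic ip A a b 0 = a,
      geodesic ip A a b 1 = b &
      forall gamma : R -> H -> H,
        smooth_curve ip A gamma -> gamma 0 = a -> gamma 1 = b ->
        (curve_length tau (geodesic ip A a b) <= curve_length tau gamma)%E].
Proof.
have [g [h [Y [sg sY gh hg [aE bE dE]]]]] := geodesicP hH hA htau ha hb.
have -> : geodesic ip A a b
    = fun t => sval (g * aexp (vnorm (htau := htau)) (t *: Y) * g) by exact/funext.
split.
- exact: (explicit_geodesic_smooth hH sg sY gh hg).
- by rewrite scale0r (aexp0 (vna_complete_norm hA htau)) mulr1.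
- by rewrite scale1r.
- move=> gamma sgam gam0 gam1; rewrite (explicit_geodesic_length hH Y gh hg).
  by apply: (explicit_geodesic_shortest hH sg sY gh hg sgam); rewrite ?gam0 ?gam1.
Qed.
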